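(* Let $a>0$, $\lambda>0$, and let $\mathcal M$ be a properly large constant. The mixed integer program $$\min\ \tfrac12q^\top\beta-\tfrac12\mathbf b^\top\rho-\tfrac12a\lambda\mathbf 1^\top\eta_4+\tfrac12\lambda n\mathbf 1^\top h$$ $$\text{s.t.}\quad\begin{cases}q+Q\beta+\eta_1-\eta_2+\mathcal A\rho=0;\quad\frac nag-\frac nah-\eta_3+\eta_4=0,\\ -n\big(\frac1ag-\lambda\mathbf 1\big)-\eta_1-\eta_2=0,\\ 0\le\eta_1\le\mathcal M\mathbf z_1;\quad0\le h-\beta\le\mathcal M(\mathbf 1-\mathbf z_1),\\ 0\le\eta_2\le\mathcal M\mathbf z_2;\quad0\le h+\beta\le\mathcal M(\mathbf 1-\mathbf z_2),\\ 0\le\eta_3\le\mathcal M\mathbf z_3;\quad0\le g\le\mathcal M(\mathbf 1-\mathbf z_3),\\ 0\le\eta_4\le\mathcal M\mathbf z_4;\quad0\le a\lambda\mathbf 1-g\le\mathcal M(\mathbf 1-\mathbf z_4),\\ 0\le\rho\le\mathcal M\mathbf z_5;\quad\mathbf b-\mathcal A^\top\beta\le\mathcal M(\mathbf 1-\mathbf z_5);\quad\mathbf b-\mathcal A^\top\beta\ge0,\\ \mathbf z_1,\mathbf z_2,\mathbf z_3,\mathbf z_4\in\{0,1\}^d;\quad\mathbf z_5\in\{0,1\}^m,\\ \beta,g,h,\eta_1,\eta_2,\eta_3,\eta_4\in\mathbb R^d;\quad\rho\in\mathbb R^m\end{cases}$$ admits algorithms that attain a global optimum in finitely many iterations.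
   Context: Setting: $n\ge1$ is the sample size, $d\ge1$ the dimension, $0\le m<d$; $Q\in\mathbb R^{d\times d}$ is symmetric (not necessarily positive semidefinite), $q\in\mathbb R^d$, $\mathcal A\in\mathbb R^{d\times m}$ has full rank, $\mathbf b\in\mathbb R^m$, and $\Lambda:=\{\beta\in\mathbb R^d:\mathcal A^\top\beta\le\mathbf b\}$ is nonempty. $\mathbf 1$ is the all-ones vector of the proper dimension; vector inequalities are componentwise. Standing assumption: the MCP penalized problem $\min_{\beta\in\Lambda}\tfrac12\beta^\top Q\beta+q^\top\beta+n\sum_{i=1}^dP_{\mathrm{MCP},\lambda}(|\beta_i|)$ has a finite global solution, where $P_{\mathrm{MCP},\lambda}(\theta)=\int_0^\theta\frac{(a\lambda-t)_+}{a}\,dt$ for $\theta\ge0$ and $(b)_+=\max\{b,0\}$. The constraints involving $\mathcal M$ and the binary vectors $\mathbf z_1,\dots,\mathbf z_5$ encode the complementarity conditions $0\le\eta_1\perp h-\beta\ge0$, $0\le\eta_2\perp h+\beta\ge0$, $0\le\eta_3\perp g\ge0$, $0\le\eta_4\perp a\lambda\mathbf 1-g\ge0$, $0\le\rho\perp\mathbf b-\mathcal A^\top\beta\ge0$ (where $0\le\Phi\perp\Delta\ge0$ means $\phi_i\ge0$, $\delta_i\ge0$, $\phi_i\delta_i=0$ for all $i$). ''Properly large'' means: $\mathcal M$ is large enough that some global minimizer of the same objective under the three displayed equality constraints together with these complementarity conditions has all entries of $\eta_1,\eta_2,\eta_3,\eta_4,\rho,h-\beta,h+\beta,g,a\lambda\mathbf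 1-g,\mathbf b-\mathcal A^\top\beta$ at most $\mathcal M$. *)

(* Defs.v *)
From mathcomp Require Import all_boot all_order all_algebra.
From mathcomp Require Import all_classical all_reals all_analysis.

Set Implicit Arguments.
Unset Strict Implicit.
Unset Printing Implicit Defensive.

Import Order.TTheory GRing.Theory Num.Theory.

Local Open Scope classical_set_scope.
Local Open Scope ring_scope.

Section Vectors.
Context {R : realType}.

Definition dot k (u v : 'cV[R]_k) : R := (u^T *m v) 0 0.
Definition ones k : 'cV[R]_k := const_mx 1.
Definition lev k (u v : 'cV[R]_k) : Prop := forall i, u i 0 <= v i 0.
Definition binary k (z : 'cV[R]_k) : Prop := forall i, z i 0 = 0 \/ z i 0 = 1.

(* 0 <= phi _|_ delta >= 0 *)
Definition perp k (phi delta : 'cV[R]_k) : Prop :=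
  [/\ lev 0 phi, lev 0 delta & forall i, phi i 0 * delta i 0 = 0].

(* the linearization of [perp phi delta] by the binary vector z *)
Definition bigM k (M : R) (z phi delta : 'cV[R]_k) : Prop :=
  [/\ lev 0 phi, lev phi (M *: z), lev 0 delta & lev delta (M *: (ones k - z))].

End Vectors.

(* The data of the penalized problem; [thr] is the parameter a. *)
Record mcp_data (R : realType) (d m : nat) := McpData {
  smp : nat;  (* n *)
  Qmat : 'M[R]_d;
  qvec : 'cV[R]_d;
  Amat : 'M[R]_(d, m);
  bvec : 'cV[R]_m;
  thr : R;
  lam : R
}.

Section PenalizedProblem.
Context {R : realType} {d m : nat}.
Variable D : mcp_data R d m.

Definition mcp_penalty (theta : R) : R :=
  \int[lebesgue_measure]_(t in `[0, theta])
    (Num.max (thr D * lam D - t) 0 / thr D).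

Definition in_Lambda (beta : 'cV[R]_d) : Prop :=
  lev ((Amat D)^T *m beta) (bvec D).

Definition mcp_objective (beta : 'cV[R]_d) : R :=
  2^-1 * dot beta (Qmat D *m beta) + dot (qvec D) beta
  + (smp D)%:R * \sum_(i < d) mcp_penalty `|beta i 0|.

Definition mcp_has_global_solution : Prop :=
  exists2 beta, in_Lambda beta
  & forall beta', in_Lambda beta' -> mcp_objective beta <= mcp_objective beta'.

End PenalizedProblem.

Record cont_vars (R : realType) (d m : nat) := ContVars {
  beta : 'cV[R]_d;
  gg : 'cV[R]_d;
  hh : 'cV[R]_d;
  eta1 : 'cV[R]_d;
  eta2 : 'cV[R]_d;
  eta3 : 'cV[R]_d;
  eta4 : 'cV[R]_d;
  rho : 'cV[R]_m
}.

Record bin_vars (R : realType) (d m : nat) := BinVars {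
  z1 : 'cV[R]_d;
  z2 : 'cV[R]_d;
  z3 : 'cV[R]_d;
  z4 : 'cV[R]_d;
  z5 : 'cV[R]_m
}.

Section MixedIntegerProgram.
Context {R : realType} {d m : nat}.
Variable D : mcp_data R d m.
Local Notation n := ((smp D)%:R : R).
Local Notation a := (thr D).

Definition objective (x : cont_vars R d m) : R :=
  2^-1 * dot (qvec D) (beta x) - 2^-1 * dot (bvec D) (rho x)
  - 2^-1 * a * lam D * dot (ones d) (eta4 x)
  + 2^-1 * lam D * n * dot (ones d) (hh x).

Definition equalities (x : cont_vars R d m) : Prop :=
  [/\ qvec D + Qmat D *m beta x + eta1 x - eta2 x + Amat D *m rho x = 0,
      (n / a) *: gg x - (n / a) *: hh x - eta3 x + eta4 x = 0
    & - (n *: (a^-1 *: gg x - lam D *: ones d)) - eta1 x - eta2 x = 0].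

Definition complementarities (x : cont_vars R d m) : Prop :=
  [/\ perp (eta1 x) (hh x - beta x),
      perp (eta2 x) (hh x + beta x),
      perp (eta3 x) (gg x),
      perp (eta4 x) ((a * lam D) *: ones d - gg x)
    & perp (rho x) (bvec D - (Amat D)^T *m beta x)].

Definition entries_le (M : R) (x : cont_vars R d m) : Prop :=
  [/\ [/\ lev (eta1 x) (M *: ones d), lev (eta2 x) (M *: ones d),
          lev (eta3 x) (M *: ones d), lev (eta4 x) (M *: ones d)
        & lev (rho x) (M *: ones m)],
      lev (hh x - beta x) (M *: ones d) /\ lev (hh x + beta x) (M *: ones d),
      lev (gg x) (M *: ones d),
      lev ((a * lam D) *: ones d - gg x) (M *: ones d)
    & lev (bvec D - (Amat D)^T *m beta x) (M *: ones m)].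

Definition properly_large (M : R) : Prop :=
  exists x : cont_vars R d m,
    [/\ equalities x, complementarities x,
        forall y, equalities y -> complementarities y ->
          objective x <= objective y
      & entries_le M x].

Definition mip_feasible (M : R) (x : cont_vars R d m) (z : bin_vars R d m) :
    Prop :=
  [/\ equalities x,
      [/\ bigM M (z1 z) (eta1 x) (hh x - beta x),
          bigM M (z2 z) (eta2 x) (hh x + beta x),
          bigM M (z3 z) (eta3 x) (gg x),
          bigM M (z4 z) (eta4 x) ((a * lam D) *: ones d - gg x)
        & bigM M (z5 z) (rho x) (bvec D - (Amat D)^T *m beta x)]
    & [/\ binary (z1 z), binary (z2 z), binary (z3 z), binary (z4 z)
        & binary (z5 z)]].

Definition mip_global_optimum (M : R) (x : cont_vars R d m)
    (z : bin_vars R d m) : Prop :=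
  mip_feasible M x z /\
  forall x' z', mip_feasible M x' z' -> objective x <= objective x'.

End MixedIntegerProgram.

(* Algorithms are finite programs of a real random access machine: exact
   arithmetic and comparisons on real numbers (with the convention 0^-1 = 0),
   natural-number variables used as counters and addresses, and two-dimensional
   real arrays.  No real constant other than a natural number can be written in
   a program, so the real data of an instance enter only through the initial
   contents of the arrays, and one program has to serve all instances. *)

Inductive nexp :=
| NLit of nat
| NVar of nat
| NAdd of nexp & nexp
| NSub of nexp & nexp
| NMul of nexp & nexp
| NDiv of nexp & nexp
| NMod of nexp & nexp.

Inductive rexp :=
| RNat of nexp
| RGet of nat & nexp & nexp  (* array, row, column *)
| RAdd of rexp & rexp
| ROpp of rexp
| RMul of rexp & rexp
| RInv of rexp.

Inductive bexp :=
| BNle of nexp & nexp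
| BRle of rexp & rexp
| BNot of bexp
| BAnd of bexp & bexp.

Inductive cmd :=
| Skip
| NSet of nat & nexp
| RSet of nat & nexp & nexp & rexp
| Seq of cmd & cmd
| If of bexp & cmd & cmd
| While of bexp & cmd.

Section Machine.
Context {R : realType}.

Record state := State {
  nvar : nat -> nat;
  rarr : nat -> nat -> nat -> R
}.

Fixpoint neval (s : state) (e : nexp) : nat :=
  match e with
  | NLit k => k
  | NVar v => nvar s v
  | NAdd e1 e2 => (neval s e1 + neval s e2)%N
  | NSub e1 e2 => (neval s e1 - neval s e2)%N
  | NMul e1 e2 => (neval s e1 * neval s e2)%N
  | NDiv e1 e2 => (neval s e1 %/ neval s e2)%N
  | NMod e1 e2 => (neval s e1 %% neval s e2)%N
  end.

Fixpoint reval (s : state) (e : rexp) : R :=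
  match e with
  | RNat e1 => (neval s e1)%:R
  | RGet t e1 e2 => rarr s t (neval s e1) (neval s e2)
  | RAdd e1 e2 => reval s e1 + reval s e2
  | ROpp e1 => - reval s e1
  | RMul e1 e2 => reval s e1 * reval s e2
  | RInv e1 => (reval s e1)^-1
  end.

Fixpoint beval (s : state) (e : bexp) : bool :=
  match e with
  | BNle e1 e2 => (neval s e1 <= neval s e2)%N
  | BRle e1 e2 => reval s e1 <= reval s e2
  | BNot e1 => ~~ beval s e1
  | BAnd e1 e2 => beval s e1 && beval s e2
  end.

Definition set_nvar (s : state) (v k : nat) : state :=
  State (fun w => if w == v then k else nvar s w) (rarr s).

Definition set_rarr (s : state) (t i j : nat) (r : R) : state :=
  State (nvar s)
    (fun t' i' j' =>
       if [&& t' == t, i' == i & j' == j] then r else rarr s t' i' j').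

(* A configuration is the stack of commands still to be run, and the state.  It
   is halted when the stack is empty.  One iteration is one [step]. *)
Definition step (c : seq cmd * state) : seq cmd * state :=
  let: (k, s) := c in
  match k with
  | [::] => ([::], s)
  | Skip :: k' => (k', s)
  | NSet v e :: k' => (k', set_nvar s v (neval s e))
  | RSet t e1 e2 e :: k' =>
      (k', set_rarr s t (neval s e1) (neval s e2) (reval s e))
  | Seq c1 c2 :: k' => (c1 :: c2 :: k', s)
  | If b c1 c2 :: k' => ((if beval s b then c1 else c2) :: k', s)
  | While b c1 :: k' => (if beval s b then c1 :: k else k', s)
  end.

Definition halts_within (p : cmd) (s : state) (N : nat) (s' : state) : Prop :=
  iter N step ([:: p], s) = ([::], s').

Definition mx_array k l (B : 'M[R]_(k, l)) (i j : nat) : R :=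
  match insub i, insub j with
  | Some i', Some j' => B i' j'
  | _, _ => 0
  end.

(* n, d, m are given in the natural-number variables 0, 1, 2. *)
Definition load d m (D : mcp_data R d m) (M : R) : state :=
  State
    (fun v => match v with 0 => smp D | 1 => d | 2 => m | _ => 0 end)%N
    (fun t => match t with
      | 0%N => mx_array (const_mx (thr D) : 'cV[R]_1)
      | 1%N => mx_array (const_mx (lam D) : 'cV[R]_1)
      | 2%N => mx_array (const_mx M : 'cV[R]_1)
      | 3%N => mx_array (Qmat D)
      | 4%N => mx_array (qvec D)
      | 5%N => mx_array (Amat D)
      | 6%N => mx_array (bvec D)
      | _ => fun _ _ => 0
      end).

Definition read_vec k (s : state) (t : nat) : 'cV[R]_k :=
  \col_i rarr s t i 0%N.

Definition out_cont d m (s : state) : cont_vars R d m :=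
  ContVars (read_vec d s 7) (read_vec d s 8) (read_vec d s 9)
    (read_vec d s 10) (read_vec d s 11) (read_vec d s 12) (read_vec d s 13)
    (read_vec m s 14).

Definition out_bin d m (s : state) : bin_vars R d m :=
  BinVars (read_vec d s 15) (read_vec d s 16) (read_vec d s 17)
    (read_vec d s 18) (read_vec m s 19).

End Machine.

Arguments state : clear implicits.

(* Main.v *)
Require Import Defs.
From mathcomp Require Import all_boot all_order all_algebra.
From mathcomp Require Import all_classical all_reals all_analysis.
From mathcomp Require Import zify ring lra.

Import Order.TTheory GRing.Theory Num.Theory.
Local Open Scope ring_scope.

(** Forget the binary vectors: a point of the program is then a solution of
    linear equations and inequalities in which certain products of two
    inequality slacks vanish.  Because the constant is properly large, an
    optimum of the complementarity problem is among these points, so that a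
    minimum exists and equals the minimum without the upper bounds; and the
    binary vectors are recovered as phi / phi, which is 0 where phi = 0 and 1
    elsewhere ([perp_bigM]).

    The inequalities bound every unknown, so the region contains no ray.  Let an
    optimal point not be determined by its tight inequalities: then some
    direction keeps all of them tight.  Along this direction, or along its
    opposite, the objective does not increase, and some inequality must
    eventually become tight; the vanishing products survive, since a vanishing
    slack is a tight row ([slide]).  The number of tight rows has grown, so
    after finitely many slides there is an optimum which is the only solution of
    the linear system of its tight rows ([vertex]).  It is therefore enough to
    run through all sets of rows, solve the linear system of each, and keep the
    best solution which is feasible ([search]).

    After homogenization (an extra coordinate, equal to 1) the solutions of a
    system are the vectors orthogonal to its rows.  The orthogonal projector
    onto them is the identity, updated once for each row a by
    P - p p^T / (a . p) with p = P a.  When a depends on earlier rows, p = 0 and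
    the convention 0^-1 = 0 makes the update void: neither a pivot nor a test is
    needed.  When the solution y is unique the final projector has rank one, and
    its last column is a nonzero multiple of y ([proj_solve]).

    Programs are verified with a predicate transformer on a big-step semantics.
    All loops are counted loops ([wp_for]), and what a loop leaves unchanged is
    read off its text ([exec_agree]). *)

(** * Program logic for the random access machine *)

Section Logic.
Context {R : realType}.
Implicit Types (s : state R) (c : cmd).

Inductive exec : cmd -> state R -> state R -> Prop :=
| exec_skip s : exec Skip s s
| exec_nset v e s : exec (NSet v e) s (set_nvar s v (neval s e))
| exec_rset t e1 e2 e s :
    exec (RSet t e1 e2 e) s
      (set_rarr s t (neval s e1) (neval s e2) (reval s e))
| exec_seq c1 c2 s s1 s2 :
    exec c1 s s1 -> exec c2 s1 s2 -> exec (Seq c1 c2) s s2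
| exec_if b c1 c2 s s1 :
    exec (if beval s b then c1 else c2) s s1 -> exec (If b c1 c2) s s1
| exec_while_stop b c s : beval s b = false -> exec (While b c) s s
| exec_while_step b c s s1 s2 :
    beval s b -> exec c s s1 -> exec (While b c) s1 s2 ->
    exec (While b c) s s2.

(** The stack below a command is never inspected while the command runs, so the
    statement can quantify over it; this is what the induction needs for
    sequences and loops. *)
Lemma exec_iter c s s' : exec c s s' ->
  forall k, exists N, iter N step (c :: k, s) = (k, s').
Proof.
elim=> {c s s'}.
- by move=> s k; exists 1%N.
- by move=> v e s k; exists 1%N.
- by move=> t e1 e2 e s k; exists 1%N.
- move=> c1 c2 s s1 s2 _ IH1 _ IH2 k.
  have [N1 h1] := IH1 (c2 :: k); have [N2 h2] := IH2 k.
  by exists (N2 + (N1 + 1))%N; rewrite iterD (iterD N1 1) /= h1 h2.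
- move=> b c1 c2 s s1 _ IH k; have [N h] := IH k.
  by exists (N + 1)%N; rewrite iterD /= h.
- by move=> b c s hb k; exists 1%N; rewrite /= hb.
- move=> b c s s1 s2 hb _ IH1 _ IH2 k.
  have [N1 h1] := IH1 (While b c :: k); have [N2 h2] := IH2 k.
  by exists (N2 + (N1 + 1))%N; rewrite iterD (iterD N1 1) /= hb h1 h2.
Qed.

Fixpoint wvars c : seq nat :=
  match c with
  | Skip => [::]
  | NSet v _ => [:: v]
  | RSet _ _ _ _ => [::]
  | Seq c1 c2 => wvars c1 ++ wvars c2
  | If _ c1 c2 => wvars c1 ++ wvars c2
  | While _ c1 => wvars c1
  end.

Fixpoint warrs c : seq nat :=
  match c with
  | Skip => [::]
  | NSet _ _ => [::]
  | RSet t _ _ _ => [:: t]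
  | Seq c1 c2 => warrs c1 ++ warrs c2
  | If _ c1 c2 => warrs c1 ++ warrs c2
  | While _ c1 => warrs c1
  end.

Definition agree (vs ts : seq nat) s s' : Prop :=
  (forall v, v \notin vs -> nvar s' v = nvar s v) /\
  (forall t, t \notin ts -> rarr s' t = rarr s t).

Lemma agree_refl vs ts s : agree vs ts s s.
Proof. by []. Qed.

Lemma agree_trans vs ts s1 s2 s3 :
  agree vs ts s1 s2 -> agree vs ts s2 s3 -> agree vs ts s1 s3.
Proof.
by move=> [a b] [a' b']; split=> v h; [rewrite a' ?a | rewrite b' ?b].
Qed.

Lemma agree_sub vs ts vs' ts' s s' :
  {subset vs <= vs'} -> {subset ts <= ts'} ->
  agree vs ts s s' -> agree vs' ts' s s'.
Proof.
move=> hv ht [a b]; split=> v h; [apply: a | apply: b];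
  apply: contra h; [exact: hv | exact: ht].
Qed.

(** The written variables and arrays are read off the text of the program, so
    that an invariant never has to mention what a loop leaves alone. *)
Lemma exec_agree c s s' : exec c s s' -> agree (wvars c) (warrs c) s s'.
Proof.
elim=> {c s s'}; do ?by move=> *; exact: agree_refl.
- by move=> v e s; split=> //= w; rewrite inE => /negbTE ->.
- move=> t e1 e2 e s; split=> //= t'; rewrite inE => /negbTE h.
  by apply/funext => i; apply/funext => j; rewrite h.
- move=> c1 c2 s s1 s2 _ h1 _ h2; apply: (@agree_trans _ _ _ s1).
    by apply: agree_sub h1 => x; rewrite /= mem_cat => ->.
  by apply: agree_sub h2 => x; rewrite /= mem_cat => ->; rewrite orbT.
- move=> b c1 c2 s s1 _; case: (beval s b) => h;
    by apply: agree_sub h => x; rewrite /= mem_cat => ->; rewrite ?orbT.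
- by move=> b c s s1 s2 _ _ h1 _ h2; exact: (agree_trans _ _ _ _ _ h1).
Qed.

Fixpoint nvars (e : nexp) : seq nat :=
  match e with
  | NLit _ => [::]
  | NVar v => [:: v]
  | NAdd e1 e2 | NSub e1 e2 | NMul e1 e2 | NDiv e1 e2 | NMod e1 e2 =>
      nvars e1 ++ nvars e2
  end.

Fixpoint rvars (e : rexp) : seq nat :=
  match e with
  | RNat e1 => nvars e1
  | RGet _ e1 e2 => nvars e1 ++ nvars e2
  | RAdd e1 e2 | RMul e1 e2 => rvars e1 ++ rvars e2
  | ROpp e1 | RInv e1 => rvars e1
  end.

Fixpoint rarrs (e : rexp) : seq nat :=
  match e with
  | RNat _ => [::]
  | RGet t _ _ => [:: t]
  | RAdd e1 e2 | RMul e1 e2 => rarrs e1 ++ rarrs e2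
  | ROpp e1 | RInv e1 => rarrs e1
  end.

Lemma neval_ext s s' e :
  {in nvars e, nvar s =1 nvar s'} -> neval s e = neval s' e.
Proof.
elim: e => //= [v h | e1 IH1 e2 IH2 h | e1 IH1 e2 IH2 h | e1 IH1 e2 IH2 h
  | e1 IH1 e2 IH2 h | e1 IH1 e2 IH2 h];
  first by apply: h; rewrite inE.
all: by rewrite IH1 ?IH2 // => v hv; apply: h; rewrite mem_cat hv ?orbT.
Qed.

Lemma reval_ext s s' e :
  {in rvars e, nvar s =1 nvar s'} -> {in rarrs e, rarr s =1 rarr s'} ->
  reval s e = reval s' e.
Proof.
elim: e => //= [e h _ | t e1 e2 h ht | e1 IH1 e2 IH2 h ht | e IH h ht
   | e1 IH1 e2 IH2 h ht | e IH h ht].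
- by rewrite (neval_ext s s').
- rewrite ht ?inE // (neval_ext s s' e1) ?(neval_ext s s' e2) // => v hv;
    by apply: h; rewrite mem_cat hv ?orbT.
- by rewrite IH1 ?IH2 // => v hv; [apply: h|apply: ht|apply: h|apply: ht];
    rewrite mem_cat hv ?orbT.
- by rewrite IH.
- by rewrite IH1 ?IH2 // => v hv; [apply: h|apply: ht|apply: h|apply: ht];
    rewrite mem_cat hv ?orbT.
- by rewrite IH.
Qed.

Definition wp c s (Q : state R -> Prop) : Prop :=
  exists2 s', exec c s s' & Q s'.

Lemma wp_cons c s (Q Q' : state R -> Prop) :
  wp c s Q ->
  (forall s', agree (wvars c) (warrs c) s s' -> Q s' -> Q' s') -> wp c s Q'.
Proof.
by move=> [s' h hQ] hh; exists s' => //; apply: hh => //; exact: exec_agree.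
Qed.

Lemma wp_skip s (Q : state R -> Prop) : Q s -> wp Skip s Q.
Proof. by move=> h; exists s => //; constructor. Qed.

Lemma wp_nset v e s (Q : state R -> Prop) :
  Q (set_nvar s v (neval s e)) -> wp (NSet v e) s Q.
Proof. by move=> h; eexists; [constructor | exact: h]. Qed.

Lemma wp_rset t e1 e2 e s (Q : state R -> Prop) :
  Q (set_rarr s t (neval s e1) (neval s e2) (reval s e)) ->
  wp (RSet t e1 e2 e) s Q.
Proof. by move=> h; eexists; [constructor | exact: h]. Qed.

Lemma wp_seq c1 c2 s (Q : state R -> Prop) :
  wp c1 s (fun s1 => wp c2 s1 Q) -> wp (Seq c1 c2) s Q.
Proof.
by move=> [s1 h1 [s2 h2 hQ]]; exists s2 => //; apply: exec_seq h1 h2.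
Qed.

Lemma wp_if b c1 c2 s (Q : state R -> Prop) :
  wp (if beval s b then c1 else c2) s Q -> wp (If b c1 c2) s Q.
Proof. by move=> [s1 h1 hQ]; exists s1 => //; constructor. Qed.

Definition For (v : nat) (e : nexp) (c : cmd) : cmd :=
  Seq (NSet v (NLit 0))
    (While (BNot (BNle e (NVar v))) (Seq c (NSet v (NAdd (NVar v) (NLit 1))))).

(** The bound is evaluated again before every turn, hence the requirement that
    the body write none of its variables.  Stability of the invariant under
    assignments to the counter lets the increment pass unnoticed. *)
Lemma wp_for v e c s0 (I : nat -> state R -> Prop) (Q : state R -> Prop) :
  v \notin wvars c -> ~~ has (mem (v :: wvars c)) (nvars e) ->
  (forall i s k, I i s -> I i (set_nvar s v k)) ->
  I 0%N s0 ->
  (forall i s, (i < neval s0 e)%N -> agree (v :: wvars c) (warrs c) s0 s ->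
     nvar s v = i -> I i s -> wp c s (I i.+1)) ->
  (forall s, agree (v :: wvars c) (warrs c) s0 s -> I (neval s0 e) s -> Q s) ->
  wp (For v e c) s0 Q.
Proof.
move=> vc /hasPn ve Iv I0 Is IQ; apply: wp_seq; apply: wp_nset => /=.
set n := neval s0 e.
have ev s : agree (v :: wvars c) (warrs c) s0 s -> neval s e = n.
  move=> [a _]; apply: neval_ext => w hw; apply: a; exact: (ve w hw).
have av s k : agree (v :: wvars c) (warrs c) s (set_nvar s v k).
  by split=> //= w; rewrite inE negb_or => /andP[/negbTE ->].
suff loop k i s : (i + k)%N = n -> nvar s v = i ->
    agree (v :: wvars c) (warrs c) s0 s -> I i s ->
    wp (While (BNot (BNle e (NVar v)))
          (Seq c (NSet v (NAdd (NVar v) (NLit 1))))) s Q.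
  apply: (loop n 0%N) => //; first by rewrite /= eqxx.
  - exact: Iv.
elim: k i s => [|k IH] i s hik hv ha hI.
  exists s; last by apply: IQ => //; rewrite -/n -hik addn0.
  by apply: exec_while_stop; rewrite /= ev // hv -hik addn0 leqnn.
have hi : (i < n)%N by lia.
have [s1 e1 h1] := Is i s hi ha hv hI.
have a1 := exec_agree _ _ _ e1.
have v1 : nvar s1 v = i by rewrite a1.1.
set s2 := set_nvar s1 v (neval s1 (NAdd (NVar v) (NLit 1))).
have [||||s3 e3 h3] := IH i.+1 s2; first by lia.
- by rewrite /s2 /= eqxx v1 addn1.
- apply: (agree_trans _ _ _ _ _ ha); apply: (agree_trans _ _ _ _ _ _ (av _ _)).
  by apply: agree_sub a1 => // x hx; rewrite inE hx orbT.
- exact: Iv.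
exists s3 => //; apply: exec_while_step e3; first by rewrite /= ev // hv -ltnNge.
by apply: exec_seq e1 _; exact: exec_nset.
Qed.

Definition accum (t : nat) (ei ej : nexp) (v : nat) (en : nexp) (e : rexp) :=
  Seq (RSet t ei ej (RNat (NLit 0)))
    (For v en (RSet t ei ej (RAdd (RGet t ei ej) e))).

(** The summand may read anything but the array that holds the accumulator: it
    is evaluated in states that differ from the initial one in that array. *)
Lemma wp_accum t ei ej v en e s (f : nat -> R) :
  v \notin nvars en -> v \notin nvars ei -> v \notin nvars ej ->
  (forall j s', (j < neval s en)%N -> agree [:: v] [:: t] s s' ->
     nvar s' v = j -> reval s' e = f j) ->
  wp (accum t ei ej v en e) s (fun s' =>
    rarr s' t (neval s ei) (neval s ej) = \sum_(j < neval s en) f j /\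
    forall i j, (i != neval s ei) || (j != neval s ej) ->
      rarr s' t i j = rarr s t i j).
Proof.
move=> hn hi hj hf; apply: wp_seq; apply: wp_rset.
set s1 := set_rarr _ _ _ _ _.
have en1 : neval s1 en = neval s en by apply: neval_ext.
have s1P : agree [:: v] [:: t] s s1.
  by split=> //= t'; rewrite inE => /negbTE h;
    apply/funext => i; apply/funext => j; rewrite h.
pose J k (s' : state R) :=
  rarr s' t (neval s ei) (neval s ej) = \sum_(j < k) f j /\
    forall i j, (i != neval s ei) || (j != neval s ej) ->
      rarr s' t i j = rarr s t i j.
apply: (wp_for _ _ _ _ J) => //.
- by apply/hasPn => w hw; rewrite /= inE; apply: contraNneq hn => <-.
- rewrite /J /= !eqxx big_ord0; split=> // i j.
  by rewrite -negb_and => /negbTE ->.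
- move=> k s2 hk a2 hv [h1 h2]; apply: wp_rset => /=.
  rewrite en1 in hk.
  have a02 : agree [:: v] [:: t] s s2 by apply: agree_trans a2.
  have evi e0 : v \notin nvars e0 -> neval s2 e0 = neval s e0.
    move=> h0; apply: neval_ext => w hw; apply: a02.1.
    by rewrite inE; apply: contraNneq h0 => <-.
  rewrite /J /= !evi // !eqxx h1 (hf k) // big_ord_recr /=; split=> // i j hij.
  by rewrite -negb_and in hij *; rewrite (negbTE hij) h2 // -negb_and.
- by move=> s2 a2; rewrite en1.
Qed.

Definition fill (t v0 : nat) (e0 : nexp) (v1 : nat) (e1 : nexp) (e : rexp) :=
  For v0 e0 (For v1 e1 (RSet t (NVar v0) (NVar v1) e)).

(** The expression may read the cell about to be overwritten, which still has
    its initial value; this allows an array to be updated in place. *)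
Lemma wp_fill t v0 e0 v1 e1 e s (f : nat -> nat -> R) :
  v0 != v1 -> ~~ has (mem [:: v0; v1]) (nvars e0) ->
  ~~ has (mem [:: v0; v1]) (nvars e1) ->
  (forall i j s', (i < neval s e0)%N -> (j < neval s e1)%N ->
     agree [:: v0; v1] [:: t] s s' -> nvar s' v0 = i -> nvar s' v1 = j ->
     rarr s' t i j = rarr s t i j -> reval s' e = f i j) ->
  wp (fill t v0 e0 v1 e1 e) s (fun s' =>
    forall i j, (i < neval s e0)%N -> (j < neval s e1)%N ->
      rarr s' t i j = f i j).
Proof.
move=> v01 h0 h1 hf.
pose J (k l : nat) (s' : state R) := forall i j,
  rarr s' t i j = if ((i < k) || (i == k) && (j < l))%N && (j < neval s e1)%N
                  then f i j else rarr s t i j.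
apply: (wp_for _ _ _ _ (fun k => J k 0%N)) => //.
- by rewrite /= inE inE orbb.
- by apply: contra h0 => /hasP[w hw hh]; apply/hasP; exists w => //;
    move: hh; rewrite /= !inE orbb.
- by move=> i j; rewrite ltn0 /= andbF.
- move=> k s1 hk a1 hv hJ.
  have ee : neval s1 e1 = neval s e1.
    apply: neval_ext => w hw; apply: a1.1; rewrite /= !inE orbb.
    by move/hasPn: h1 => /(_ w hw); rewrite /= !inE.
  have a1' : agree [:: v0; v1] [:: t] s s1.
    by apply: agree_sub a1 => x //=; rewrite !inE orbb.
  apply: (wp_for _ _ _ _ (J k)) => //.
  + by apply: contra h1 => /hasP[w hw hh]; apply/hasP; exists w => //;
      move: hh; rewrite /= !inE => ->; rewrite orbT.
  + move=> l s2 hl a2 hv1 hJ2; apply: wp_rset => /=.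
    have v0s : nvar s2 v0 = k by rewrite a2.1 //= inE.
    rewrite ee in hl.
    have a2' : agree [:: v0; v1] [:: t] s s2.
      apply: (agree_trans _ _ _ _ _ a1'); apply: agree_sub a2 => x //=.
      by rewrite !inE => ->; rewrite orbT.
    rewrite (hf k l) //; last by rewrite hJ2 ltnn ltnn andbF.
    move=> i j; rewrite /= eqxx v0s hv1 /= hJ2.
    case: (eqVneq i k) => [->|ik] /=; last by rewrite !orbF.
    rewrite ltnn /= ltnS (leq_eqVlt j l).
    by case: (eqVneq j l) => [->|] /=; rewrite ?hl.
  + move=> s2 a2; rewrite ee => hJ2 i j.
    rewrite hJ2 (ltnS i k) (leq_eqVlt i k) ltn0 andbF orbF.
    by case: (eqVneq i k) => [->|] //=; rewrite ?ltnn /= ?andbb ?orbF.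
- by move=> s1 a1 hJ i j hi hj; rewrite hJ hi hj.
Qed.

End Logic.

(** * Orthogonal projectors and vertices *)

Section Dot.
Context {R : realType} {n : nat}.
Implicit Types (u v w : 'cV[R]_n).

Lemma dotE u v : dot u v = \sum_i u i 0 * v i 0.
Proof. by rewrite /dot mxE; apply: eq_bigr => i _; rewrite mxE. Qed.

Lemma dotC u v : dot u v = dot v u.
Proof. by rewrite !dotE; apply: eq_bigr => i _; rewrite mulrC. Qed.

Lemma dotDr u v w : dot u (v + w) = dot u v + dot u w.
Proof. by rewrite /dot mulmxDr mxE. Qed.

Lemma dotZr u c v : dot u (c *: v) = c * dot u v.
Proof. by rewrite /dot -scalemxAr mxE. Qed.

Lemma dotNr u v : dot u (- v) = - dot u v.
Proof. by rewrite -scaleN1r dotZr mulN1r. Qed.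

Lemma dotZl c u v : dot (c *: u) v = c * dot u v.
Proof. by rewrite dotC dotZr dotC. Qed.

Lemma dot0l v : dot 0 v = 0.
Proof. by rewrite /dot trmx0 mul0mx mxE. Qed.

Lemma dot0r u : dot u 0 = 0.
Proof. by rewrite dotC dot0l. Qed.

Lemma dot_mulmx u (P : 'M[R]_n) v : dot u (P *m v) = dot (P^T *m u) v.
Proof. by rewrite /dot mulmxA trmx_mul trmxK. Qed.

Lemma dot_eq0 u : dot u u = 0 -> u = 0.
Proof.
rewrite dotE => /eqP; rewrite psumr_eq0 => [/allP h|i _]; last first.
  by rewrite -expr2 sqr_ge0.
apply/matrixP => i j; rewrite (ord1 j) mxE.
by have := h i (mem_index_enum _); rewrite -expr2 sqrf_eq0 => /eqP.
Qed.

Lemma outer_mulmx u v w : u *m v^T *m w = dot v w *: u.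
Proof. by rewrite -mulmxA [v^T *m w]mx11_scalar mul_mx_scalar. Qed.

End Dot.

Section Projection.
Context {R : realType} {n : nat}.

Definition proj_step (P : 'M[R]_n) (a : 'cV[R]_n) : 'M[R]_n :=
  P - (dot a (P *m a))^-1 *: (P *m a *m (P *m a)^T).

Lemma proj_stepE P a i j :
  proj_step P a i j =
  P i j - (dot a (P *m a))^-1 * ((P *m a) i 0 * (P *m a) j 0).
Proof.
by rewrite /proj_step; move: (P *m a) => p; rewrite !mxE big_ord1 !mxE.
Qed.

Fixpoint proj (a : nat -> 'cV[R]_n) (k : nat) : 'M[R]_n :=
  if k is k'.+1 then proj_step (proj a k') (a k') else 1%:M.

Definition is_proj (P : 'M[R]_n) := P^T = P /\ P *m P = P.

(** With p = P a one has P p = p and p . p = a . p, so that p p^T / (a . p) is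
    the projector onto the line of p, which lies in the image of P. *)
Lemma proj_step_proj P a : is_proj P -> is_proj (proj_step P a).
Proof.
move=> [Ps Pi]; rewrite /proj_step; set p := P *m a; set s := dot a p.
have Pp : P *m p = p by rewrite /p mulmxA Pi.
have pP : p^T *m P = p^T by rewrite -{1}Ps -[LHS]trmx_mul Pp.
have pp : p^T *m p = s%:M.
  rewrite [LHS]mx11_scalar; congr _%:M.
  by rewrite /s -[in RHS]Pp dot_mulmx Ps.
split; first by rewrite linearB /= linearZ /= trmx_mul trmxK Ps.
set O := p *m p^T.
have PO : P *m O = O by rewrite mulmxA Pp.
have OP : O *m P = O by rewrite -mulmxA pP.
have OO : O *m O = s *: O.
  by rewrite mulmxA -(mulmxA p) pp mul_mx_scalar -scalemxAl.
rewrite mulmxBl !mulmxBr Pi -!scalemxAr -!scalemxAl PO OP OO !scalerA.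
have [s0|s0] := eqVneq s 0; first by rewrite s0 invr0 !mul0r !scale0r !subr0.
by rewrite -?mulrA mulVf ?mulr1 ?subrr ?subr0.
Qed.

(** If a . p = 0 then p . p = 0, since P is a projector; so P already kills
    a. *)
Lemma proj_step_dir P a : is_proj P -> proj_step P a *m a = 0.
Proof.
move=> [Ps Pi]; rewrite /proj_step; set p := P *m a; set s := dot a p.
rewrite mulmxBl -scalemxAl outer_mulmx -/p (dotC p) -/s scalerA.
have [s0|s0] := eqVneq s 0; last by rewrite mulVf // scale1r subrr.
suff -> : p = 0 by rewrite scaler0 subrr.
by apply: dot_eq0; rewrite -s0 /s /p dot_mulmx Ps mulmxA Pi dotC.
Qed.

Lemma proj_step_fix P a v : is_proj P -> P *m v = v -> dot a v = 0 ->
  proj_step P a *m v = v.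
Proof.
move=> [Ps Pi] Pv av; rewrite /proj_step mulmxBl -scalemxAl outer_mulmx.
rewrite (dotC (P *m a) v) (dot_mulmx v) Ps Pv (dotC v) av.
by rewrite scale0r scaler0 subr0.
Qed.

Lemma proj_step_kill P a (v : 'cV_n) : is_proj P -> P *m v = 0 ->
  proj_step P a *m v = 0.
Proof.
move=> [Ps Pi] Pv; rewrite /proj_step mulmxBl -scalemxAl outer_mulmx.
by rewrite (dotC (P *m a) v) (dot_mulmx v) Ps Pv dot0l scale0r scaler0 subr0.
Qed.

Lemma projP a k : is_proj (proj a k).
Proof.
elim: k => [|k IH] /=; last exact: proj_step_proj.
by split; rewrite ?trmx1 ?mul1mx.
Qed.

Lemma proj_fix a k v :
  (forall i, (i < k)%N -> dot (a i) v = 0) -> proj a k *m v = v.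
Proof.
elim: k => [|k IH] h /=; first by rewrite mul1mx.
apply: proj_step_fix; [exact: projP | | exact: h].
by apply: IH => i hi; apply: h; apply: ltnW.
Qed.

Lemma proj_kill a k i : (i < k)%N -> proj a k *m a i = 0.
Proof.
elim: k => // k IH; rewrite ltnS leq_eqVlt => /predU1P[->|hi] /=.
  exact/proj_step_dir/projP.
by apply: proj_step_kill; [exact: projP | exact: IH].
Qed.

Lemma dot_proj a k i w : (i < k)%N -> dot (a i) (proj a k *m w) = 0.
Proof. by move=> hi; rewrite dot_mulmx (projP a k).1 proj_kill // dot0l. Qed.

Variable (N : 'I_n).

(** The column N of P, rescaled so that its coordinate N is 1 if it was not
    0. *)
Definition dehomog (P : 'M[R]_n) : 'cV[R]_n := \col_j (P j N * (P N N)^-1).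

(** The column w = P e_N is orthogonal to all rows, and y . w = (P y)_N = 1.
    If its last coordinate were 0, then y + w would be a second solution; so it
    can be rescaled to a solution, which must be y. *)
Lemma proj_solve a k (y : 'cV_n) : y N 0 = 1 ->
  (forall i, (i < k)%N -> dot (a i) y = 0) ->
  (forall y' : 'cV_n, y' N 0 = 1 ->
     (forall i, (i < k)%N -> dot (a i) y' = 0) -> y' = y) ->
  dehomog (proj a k) = y.
Proof.
move=> yN ya yu; set P := proj a k; pose w : 'cV_n := P *m delta_mx N 0.
have wE j : w j 0 = P j N by rewrite /w -colE mxE.
have wa i : (i < k)%N -> dot (a i) w = 0 by exact: dot_proj.
have yw : dot y w = 1.
  rewrite /w dot_mulmx (projP a k).1 proj_fix //.
  by rewrite /dot -colE mxE mxE.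
have wN : P N N != 0.
  rewrite -wE; apply/eqP => w0.
  have : y + w = y.
    apply: yu => [|i hi]; first by rewrite mxE yN w0 addr0.
    by rewrite dotDr ya // wa // addr0.
  move/eqP; rewrite -subr_eq0 addrAC subrr add0r => /eqP w00.
  by move/eqP: yw; rewrite w00 dot0r eq_sym oner_eq0.
have -> : dehomog P = (P N N)^-1 *: w.
  by apply/colP => i; rewrite mxE [RHS]mxE wE mulrC.
apply: yu => [|i hi]; first by rewrite mxE wE mulVf.
by rewrite dotZr wa // mulr0.
Qed.

End Projection.

Section Vertex.
Context {R : realType} {n K : nat}.
Variables (F G : nat -> 'cV[R]_n) (c : 'cV[R]_n) (N : 'I_n).

(** Rows [F r] are inequalities.  An equation is a row that is its own
    partner, since a nonnegative number with vanishing square is 0; a row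
    without complementarity condition has partner 0. *)
Definition feas (y : 'cV[R]_n) : Prop :=
  y N 0 = 1 /\ forall r, (r < K)%N ->
    0 <= dot (F r) y /\ dot (F r) y * dot (G r) y = 0.

Hypothesis FG : forall r, (r < K)%N ->
  G r = 0 \/ exists2 r', (r' < K)%N & G r = F r'.
Hypothesis pointed : forall v : 'cV_n, v N 0 = 0 ->
  (forall r, (r < K)%N -> 0 <= dot (F r) v) -> v = 0.

Definition slack (y : 'cV[R]_n) := [set r : 'I_K | dot (F r) y != 0].

(** Move from y in the direction v up to the first row that becomes tight.
    Such a row exists because v is not a recession direction. *)
Lemma slide (y v : 'cV[R]_n) : feas y -> v N 0 = 0 -> v != 0 ->
  (forall r, (r < K)%N -> dot (F r) y = 0 -> dot (F r) v = 0) ->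
  dot c v <= 0 ->
  exists y1, [/\ feas y1, dot c y1 <= dot c y & slack y1 \proper slack y].
Proof.
move=> [yN yF] vN v0 vT cv.
have [r0 r0v] : exists r : 'I_K, dot (F r) v < 0.
  apply: contrapT => h; case/eqP: v0; apply: pointed => // r hr.
  by rewrite leNgt; apply/negP => h1; apply: h; exists (Ordinal hr).
pose q (r : 'I_K) := dot (F r) y / (- dot (F r) v).
case: (@Order.TotalTheory.arg_minP _ _ _ r0
  (fun r : 'I_K => dot (F r) v < 0) q r0v).
move=> r1 r1v r1min; set t := q r1.
have t0 : 0 <= t.
  by rewrite /t /q divr_ge0 ?(yF _ (ltn_ord _)).1 // oppr_ge0 ltW.
pose y1 := y + t *: v.
have dy u : dot u y1 = dot u y + t * dot u v by rewrite dotDr dotZr.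
exists y1; split.
- split=> [|r hr]; first by rewrite !mxE vN mulr0 addr0.
  have [h1 h2] := yF r hr; split.
    rewrite dy; have [rv|rv] := leP 0 (dot (F r) v).
      by rewrite addr_ge0 // mulr_ge0.
    have := r1min (Ordinal hr) rv; rewrite -/t /q /= ler_pdivlMr ?oppr_gt0 //.
    by rewrite mulrN -subr_ge0 opprK.
  move/eqP: h2; rewrite mulf_eq0 => /orP[] /eqP h2.
    by rewrite dy h2 (vT r) // mulr0 addr0 mul0r.
  rewrite [dot (G r) y1]dy h2; case: (FG r hr) => [->|[r' hr' e]].
    by rewrite dot0l mulr0 addr0 mulr0.
  by rewrite e vT ?mulr0 ?addr0 ?mulr0 // -e.
- by rewrite dy gerDl mulr_ge0_le0.
- apply/properP; split.
    apply/fintype.subsetP => r; rewrite !inE; apply: contra => /eqP h.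
    by rewrite dy h vT ?mulr0 ?addr0.
  exists r1; rewrite !inE.
    by apply/eqP => /(vT _ (ltn_ord _)) h; rewrite h ltxx in r1v.
  rewrite negbK dy /t /q invrN mulrN mulNr divfK ?subrr //.
  by rewrite lt_eqF.
Qed.

(** Induction on the number of rows that are not tight.  Of two opposite
    directions, one does not increase the objective. *)
Lemma vertex y0 : feas y0 ->
  (forall y, feas y -> dot c y0 <= dot c y) ->
  exists y, [/\ feas y, dot c y <= dot c y0 &
    forall y' : 'cV_n, y' N 0 = 1 ->
      (forall r, (r < K)%N -> dot (F r) y = 0 -> dot (F r) y' = 0) -> y' = y].
Proof.
have [k] := ubnP #|slack y0|; elim: k y0 => // k IH y0 hk fy0 opt.
case: (pselect (forall y' : 'cV_n, y' N 0 = 1 ->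
      (forall r, (r < K)%N -> dot (F r) y0 = 0 -> dot (F r) y' = 0) ->
      y' = y0)) => [h|]; first by exists y0.
move=> /existsNP[y' /not_implyP[y'N /not_implyP[y'T ney]]].
have [y0N _] := fy0.
have step (v : 'cV[R]_n) : v N 0 = 0 -> v != 0 ->
    (forall r, (r < K)%N -> dot (F r) y0 = 0 -> dot (F r) v = 0) ->
    dot c v <= 0 ->
    exists y, [/\ feas y, dot c y <= dot c y0 &
      forall y' : 'cV_n, y' N 0 = 1 ->
      (forall r, (r < K)%N -> dot (F r) y = 0 -> dot (F r) y' = 0) -> y' = y].
  move=> vN v0 vT cv; have [y1 [f1 c1 p1]] := slide _ _ fy0 vN v0 vT cv.
  have [|//||y [fy cy uy]] := IH y1; last by exists y; split=> //; exact: le_trans c1.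
    by apply: leq_trans (proper_card p1) _.
  by move=> y fy; apply: le_trans c1 _; exact: opt.
have vN : (y' - y0) N 0 = 0 by rewrite !mxE y'N y0N subrr.
have v0 : y' - y0 != 0 by rewrite subr_eq0; apply/eqP.
have vT r : (r < K)%N -> dot (F r) y0 = 0 -> dot (F r) (y' - y0) = 0.
  by move=> hr h0; rewrite dotDr dotNr h0 y'T // subr0.
have [h|h] := leP (dot c (y' - y0)) 0; first exact: step vT h.
apply: (step (- (y' - y0))).
- by rewrite mxE vN oppr0.
- by rewrite oppr_eq0.
- by move=> r hr h0; rewrite dotNr vT ?oppr0.
- by rewrite dotNr oppr_le0 ltW.
Qed.

(** The bits of k select the rows; a row that is not selected is replaced by
    0, which does not change the projector. *)
Definition cand (k : nat) : 'cV[R]_n :=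
  dehomog N (proj (fun r => ((k %/ 2 ^ r) %% 2)%N%:R *: F r) K).

Lemma bits_of (T : nat -> bool) l :
  exists2 k, (k < 2 ^ l)%N & forall r, (r < l)%N -> ((k %/ 2 ^ r) %% 2)%N = T r.
Proof.
elim: l T => [|l IH] T; first by exists 0%N.
have [k hk kT] := IH (fun r => T r.+1).
exists (k * 2 + T 0%N)%N; first by rewrite expnS; case: (T 0%N); lia.
case=> [_|r hr]; first by rewrite expn0 divn1 modnMDl; case: (T 0%N).
rewrite expnS divnMA divnMDl // (_ : (T 0%N %/ 2)%N = 0%N) ?addn0 ?kT //.
by case: (T 0%N).
Qed.

(** The code of the set of tight rows of a vertex yields that vertex. *)
Lemma cand_opt y0 : feas y0 ->
  (forall y, feas y -> dot c y0 <= dot c y) ->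
  exists k, [/\ (k < 2 ^ K)%N, feas (cand k) & dot c (cand k) <= dot c y0].
Proof.
move=> f0 o0; have [y [fy cy uy]] := vertex _ f0 o0.
have [k hk kT] := bits_of (fun r => dot (F r) y == 0) K.
suff e : cand k = y by exists k; rewrite e.
apply: proj_solve => [|r hr|y' y'N hy']; first exact: fy.1.
  by rewrite dotZl kT //; case: eqP => [->|]; rewrite ?mulr0 ?mul0r.
apply: uy => // r hr h0.
by have := hy' r hr; rewrite dotZl kT // h0 eqxx mul1r.
Qed.

End Vertex.

(** * The search program *)

(** With truncated subtraction, 1 - ((x - y) + (y - x)) is 1 if x = y and 0
    otherwise. *)
Definition kron (e1 e2 : nexp) : rexp :=
  RNat (NSub (NLit 1) (NAdd (NSub e1 e2) (NSub e2 e1))).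

Section Program.
Variables (row_e partner_e cost_e : rexp).

(** Points have 8 blocks of d coordinates and a last coordinate of index 8 d,
    which is 1; there are 23 blocks of d rows.

    Variables: 3 is the code of the set of rows, 4 the number of codes, 5 what
    remains of the code once the bits of earlier rows are dropped, 6 the row, 7
    and 8 indices of coordinates, 9 the feasibility flag, 10 tells whether a
    feasible point has been found.  Arrays: 20 is the projector P, 21 the vector
    p, 22 the number a . p, 23 and 24 the values of a row and of its partner, 25
    and 26 the current and the best objective value, 27 the best point.

    The expressions [row_e] and [partner_e] give the entry in row 6 and column 8
    (as variables), and [cost_e] the coefficient of column 8. *)
Definition hom_exp : nexp := NMul (NLit 8) (NVar 1).
Definition dim_exp : nexp := NAdd hom_exp (NLit 1).
Definition nrows_exp : nexp := NMul (NLit 23) (NVar 1).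

Definition selected : rexp := RMul (RNat (NMod (NVar 5) (NLit 2))) row_e.

Definition project : cmd :=
  Seq (For 7 dim_exp (accum 21 (NVar 7) (NLit 0) 8 dim_exp
         (RMul (RGet 20 (NVar 7) (NVar 8)) selected)))
  (Seq (accum 22 (NLit 0) (NLit 0) 8 dim_exp
         (RMul selected (RGet 21 (NVar 8) (NLit 0))))
  (Seq (fill 20 7 dim_exp 8 dim_exp
         (RAdd (RGet 20 (NVar 7) (NVar 8))
           (ROpp (RMul (RInv (RGet 22 (NLit 0) (NLit 0)))
                    (RMul (RGet 21 (NVar 7) (NLit 0))
                          (RGet 21 (NVar 8) (NLit 0)))))))
    (NSet 5 (NDiv (NVar 5) (NLit 2))))).

Definition candidate : cmd :=
  Seq (NSet 5 (NVar 3))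
  (Seq (fill 20 7 dim_exp 8 dim_exp
         (kron (NVar 7) (NVar 8)))
    (For 6 nrows_exp project)).

(** Division by the diagonal entry makes the homogeneous coordinate 1. *)
Definition coord (e : nexp) : rexp :=
  RMul (RGet 20 e hom_exp) (RInv (RGet 20 hom_exp hom_exp)).

Definition cell (t : nat) : rexp := RGet t (NLit 0) (NLit 0).

Definition feasible_row : bexp :=
  BAnd (BRle (RNat (NLit 0)) (cell 23))
    (BAnd (BRle (RMul (cell 23) (cell 24)) (RNat (NLit 0)))
          (BRle (RNat (NLit 0)) (RMul (cell 23) (cell 24)))).

Definition check : cmd :=
  Seq (NSet 9 (NLit 1))
    (For 6 nrows_exp
      (Seq (accum 23 (NLit 0) (NLit 0) 8 dim_exp (RMul row_e (coord (NVar 8))))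
      (Seq (accum 24 (NLit 0) (NLit 0) 8 dim_exp
              (RMul partner_e (coord (NVar 8))))
        (If feasible_row Skip (NSet 9 (NLit 0)))))).

(** The homogeneous coordinate of a candidate is 1, or 0 when the last diagonal
    entry of P vanishes; the test on it discards the latter candidates. *)
Definition improves : bexp :=
  BAnd (BAnd (BNle (NLit 1) (NVar 9)) (BRle (RNat (NLit 1)) (coord hom_exp)))
    (BNot (BAnd (BNle (NLit 1) (NVar 10)) (BRle (cell 26) (cell 25)))).

Definition update : cmd :=
  Seq (accum 25 (NLit 0) (NLit 0) 8 dim_exp (RMul cost_e (coord (NVar 8))))
    (If improves
       (Seq (NSet 10 (NLit 1))
       (Seq (RSet 26 (NLit 0) (NLit 0) (cell 25))
         (fill 27 7 dim_exp 8 (NLit 1) (coord (NVar 7)))))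
       Skip).

Definition search : cmd :=
  Seq (NSet 4 (NLit 1))
  (Seq (For 6 nrows_exp (NSet 4 (NMul (NVar 4) (NLit 2))))
    (For 3 (NVar 4) (Seq candidate (Seq check update)))).

End Program.

Section Search.
Context {R : realType}.
Variables (row_e partner_e cost_e : rexp) (s0 : state R) (d : nat).
Variables (Fm Gm : nat -> nat -> R) (Cm : nat -> R).

Let W : seq nat := iota 3 8.
Let T : seq nat := iota 20 8.
Let n := (8 * d + 1)%N.
Let K := (23 * d)%N.

Hypothesis s0d : nvar s0 1 = d.
Hypothesis s0found : nvar s0 10 = 0%N.
Hypothesis FE : forall s, agree W T s0 s ->
  reval s row_e = Fm (nvar s 6) (nvar s 8).
Hypothesis GE : forall s, agree W T s0 s ->
  reval s partner_e = Gm (nvar s 6) (nvar s 8).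
Hypothesis CE : forall s, agree W T s0 s -> reval s cost_e = Cm (nvar s 8).

Variable N : 'I_n.
Hypothesis NE : nat_of_ord N = (8 * d)%N.

Let F r : 'cV[R]_n := \col_j Fm r j.
Let G r : 'cV[R]_n := \col_j Gm r j.
Let c : 'cV[R]_n := \col_j Cm j.

Lemma agree_step vs ts vs' ts' s1 s2 s3 :
  agree vs' ts' s1 s2 -> agree vs ts s2 s3 ->
  all (mem vs') vs -> all (mem ts') ts -> @agree R vs' ts' s1 s3.
Proof.
move=> h1 h2 /allP hv /allP ht; apply: agree_trans h1 _.
by apply: agree_sub h2.
Qed.

Lemma agree_nset vs ts v k s1 s2 : v \in vs ->
  agree vs ts s1 s2 -> @agree R vs ts s1 (set_nvar s2 v k).
Proof.
move=> hv [h1 h2]; split=> //= w hw; rewrite h1 //.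
by case: eqP hw => // ->; rewrite hv.
Qed.

Lemma agree_dim s : agree W T s0 s -> nvar s 1 = d.
Proof. by move=> [h _]; rewrite h. Qed.

Definition holds_mx (P : 'M[R]_n) (s : state R) :=
  forall i j : 'I_n, rarr s 20 i j = P i j.

Lemma project_wp s P :
  agree W T s0 s -> holds_mx P s ->
  wp (project row_e) s (fun s' => nvar s' 5 = (nvar s 5 %/ 2)%N /\
    holds_mx (proj_step P ((nvar s 5 %% 2)%N%:R *: F (nvar s 6))) s').
Proof.
move=> a0 hP; set b := nvar s 5; set r := nvar s 6.
set a := _ *: F r; set p := P *m a.
pose fa j : R := (b %% 2)%N%:R * Fm r j.
pose fp i : R := \sum_(j < n) rarr s 20 i j * fa j.
have pE (i : 'I_n) : fp i = p i 0.
  by rewrite mxE; apply: eq_bigr => j _; rewrite hP !mxE.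
have dn s' : agree W T s0 s' -> neval s' dim_exp = n.
  by move=> h; rewrite /= (agree_dim _ h).
apply: wp_seq; apply: (wp_cons _ _ (fun s' =>
    forall i, (i < n)%N -> rarr s' 21 i 0%N = fp i)).
  apply: (wp_for _ _ _ _ (fun k s' =>
    forall i, (i < k)%N -> rarr s' 21 i 0%N = fp i)) => //.
  - move=> k s1 hk a1 hv hI.
    have a01 := agree_step _ _ _ _ _ _ _ a0 a1 isT isT.
    apply: (wp_cons _ _ _ _ (wp_accum _ _ _ _ _ _ _
      (fun j => rarr s 20 k j * fa j) _ _ _ _)) => //.
    + move=> j s2 hj a2 hv2.
      have a02 := agree_step _ _ _ _ _ _ _ a01 a2 isT isT.
      rewrite /= FE // hv2 a2.2 // a1.2 // a2.1 // hv.
      by rewrite a2.1 // a1.1 // a2.1 // a1.1.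
    + move=> s2 a2 /= [e1 e2] i; rewrite ltnS leq_eqVlt => /predU1P[->|hi].
        by rewrite hv in e1; rewrite e1 /fp -(dn _ a01).
      by rewrite e2 ?hI // hv; move: hi; case: ltngtP.
  - by move=> s1 a1 hI; rewrite dn in hI.
move=> s1 a1 h1; have a01 := agree_step _ _ _ _ _ _ _ a0 a1 isT isT.
apply: wp_seq; apply: (wp_cons _ _ _ _ (wp_accum _ _ _ _ _ _ _
   (fun j => fa j * fp j) _ _ _ _)) => //.
  move=> j s2; rewrite (dn _ a01) => hj a2 hv.
  have a02 := agree_step _ _ _ _ _ _ _ a01 a2 isT isT.
  rewrite /= FE // hv (a2.2 21%N) // h1 //.
  by rewrite a2.1 // a1.1 // a2.1 // a1.1.
move=> s2 a2; rewrite (dn _ a01) /= => -[h2 _].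
have a02 := agree_step _ _ _ _ _ _ _ a01 a2 isT isT.
pose sg : R := \sum_(j < n) fa j * fp j.
apply: wp_seq; apply: (wp_cons _ _ _ _ (wp_fill _ _ _ _ _ _ _
   (fun i j => rarr s 20 i j - sg^-1 * (fp i * fp j)) _ _ _ _)) => //.
  move=> i j s3; rewrite (dn _ a02) => hi hj a3 hvi hvj hc.
  rewrite /= hvi hvj hc (a3.2 22%N) // h2 (a3.2 21%N) // (a2.2 21%N) //.
  by rewrite !h1 // (a2.2 20%N) // (a1.2 20%N).
move=> s3 a3; rewrite (dn _ a02) => h3; apply: wp_nset; split=> /=.
  by rewrite a3.1 // a2.1 // a1.1.
move=> i j; rewrite /= h3 // hP proj_stepE -/p -!pE.
congr (_ - _^-1 * _); rewrite dotE; apply: eq_bigr => k _.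
by rewrite -pE !mxE.
Qed.

Let rowsel k r : 'cV[R]_n := ((k %/ 2 ^ r) %% 2)%N%:R *: F r.

Lemma candidate_wp s : agree W T s0 s ->
  wp (candidate row_e) s (holds_mx (proj (rowsel (nvar s 3)) K)).
Proof.
move=> a0; set k := nvar s 3; apply: wp_seq; apply: wp_nset.
set s1 := set_nvar s 5 _.
have a01 : agree W T s0 s1 by exact: agree_nset.
have e5 : nvar s1 5 = k by [].
have dn s' : agree W T s0 s' -> neval s' dim_exp = n.
  by move=> h; rewrite /= (agree_dim _ h).
apply: wp_seq; apply: (wp_cons _ _ _ _ (wp_fill _ _ _ _ _ _ _
   (fun i j => (i == j)%:R) _ _ _ _)) => //.
  move=> i j s2; rewrite (dn _ a01) => hi hj a2 hvi hvj hc.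
  by rewrite /= hvi hvj; congr (_%:R); case: eqP => [->|]; lia.
move=> s2 a2; rewrite (dn _ a01) => h2.
have a02 := agree_step _ _ _ _ _ _ _ a01 a2 isT isT.
pose J r s' := nvar s' 5 = (k %/ 2 ^ r)%N /\ holds_mx (proj (rowsel k) r) s'.
apply: (wp_for _ _ _ _ J) => //.
- split; first by rewrite a2.1 // divn1.
  by move=> i j; rewrite h2 // mxE.
- move=> r s3 hr a3 hv [J1 J2].
  have a03 := agree_step _ _ _ _ _ _ _ a02 a3 isT isT.
  apply: (wp_cons _ _ _ _ (project_wp _ _ a03 J2)) => s4 a4 [h4 h5].
  by rewrite hv J1 in h4 h5; split=> //; rewrite h4 -divnMA -expnSr.
- by move=> s3 a3 [_]; rewrite /= (agree_dim _ a02).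
Qed.

Definition row_ok (y : 'cV[R]_n) r : bool :=
  (0 <= dot (F r) y) && (dot (F r) y * dot (G r) y == 0).

Lemma feasE y : feas F G N (K := K) y <->
  y N 0 = 1 /\ all (row_ok y) (iota 0 K).
Proof.
split=> -[h1 h2]; split=> //.
  by apply/allP => r; rewrite mem_iota => /h2[p1 /eqP p2]; rewrite /row_ok p1.
move=> r hr; have/allP/(_ r) := h2.
by rewrite mem_iota hr => /(_ isT)/andP[-> /eqP].
Qed.

Lemma coordE P s e (j : 'I_n) : holds_mx P s -> agree W T s0 s ->
  neval s e = j -> reval s (coord e) = dehomog N P j 0.
Proof.
by move=> hP a0 he; rewrite /= he (agree_dim _ a0) mxE -!hP NE.
Qed.

Lemma accum_dot s P t (e : rexp) (f : nat -> R) :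
  agree W T s0 s -> holds_mx P s -> t \in [:: 23; 24; 25]%N ->
  (forall s', agree [:: 8%N] [:: t] s s' -> reval s' e = f (nvar s' 8)) ->
  wp (accum t (NLit 0) (NLit 0) 8 dim_exp (RMul e (coord (NVar 8)))) s
   (fun s' => rarr s' t 0%N 0%N = dot (\col_(j < n) f j) (dehomog N P)).
Proof.
move=> a0 hP ht he.
have dn : neval s dim_exp = n by rewrite /= (agree_dim _ a0).
pose xn j := rarr s 20 j (8 * d)%N * (rarr s 20 (8 * d)%N (8 * d)%N)^-1.
apply: (wp_cons _ _ _ _ (wp_accum _ _ _ _ _ _ _
   (fun j => f j * xn j) _ _ _ _)) => //.
  move=> j s2 hj a2 hv; rewrite /= he // hv.
  rewrite (a2.2 20%N); last by move: ht; rewrite !inE => /or3P[]/eqP->.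
  by rewrite (a2.1 1%N) // (agree_dim _ a0).
move=> s2 a2; rewrite dn => -[-> _]; rewrite dotE; apply: eq_bigr => j _.
by rewrite !mxE -!hP NE.
Qed.

Lemma check_wp s P : agree W T s0 s -> holds_mx P s ->
  wp (check row_e partner_e) s
    (fun s' => nvar s' 9 = all (row_ok (dehomog N P)) (iota 0 K)).
Proof.
move=> a0 hP; set x := dehomog N P; apply: wp_seq; apply: wp_nset.
set s1 := set_nvar s 9 _.
have a01 : agree W T s0 s1 by exact: agree_nset.
have hP1 : holds_mx P s1 by [].
apply: (wp_for _ _ _ _ (fun k s' => nvar s' 9 = all (row_ok x) (iota 0 k)))
  => //; last by move=> s2 a2 /=; rewrite (agree_dim _ a0).
move=> r s2 hr a2 hv hI.
have a02 := agree_step _ _ _ _ _ _ _ a01 a2 isT isT.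
have hP2 : holds_mx P s2 by move=> i j; rewrite a2.2 // hP1.
apply: wp_seq; apply: (wp_cons _ _ _ _ (accum_dot _ _ _ _ (Fm r) a02 hP2 _ _))
  => //.
  move=> s3 a3; have a03 := agree_step _ _ _ _ _ _ _ a02 a3 isT isT.
  by rewrite FE // (a3.1 6%N) // hv.
move=> s3 a3 h3; have a03 := agree_step _ _ _ _ _ _ _ a02 a3 isT isT.
have hP3 : holds_mx P s3 by move=> i j; rewrite a3.2 // hP2.
apply: wp_seq; apply: (wp_cons _ _ _ _ (accum_dot _ _ _ _ (Gm r) a03 hP3 _ _))
  => //.
  move=> s4 a4; have a04 := agree_step _ _ _ _ _ _ _ a03 a4 isT isT.
  by rewrite GE // (a4.1 6%N) // (a3.1 6%N) // hv.
move=> s4 a4 h4; apply: wp_if.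
have -> : beval s4 feasible_row = row_ok x r.
  by rewrite /= h4 (a4.2 23%N) // h3 /row_ok -eq_le.
have h9 : nvar s4 9 = all (row_ok x) (iota 0 r) by rewrite a4.1 // a3.1.
have iS : all (row_ok x) (iota 0 r.+1) =
    all (row_ok x) (iota 0 r) && row_ok x r.
  by rewrite -[in LHS]addn1 iotaD all_cat /= andbT.
case: (row_ok x r) iS => iS.
  by apply: wp_skip; rewrite [RHS](congr1 nat_of_bool iS) h9 andbT.
by apply: wp_nset; rewrite [RHS](congr1 nat_of_bool iS) andbF.
Qed.

Let cnd k := cand F N k (K := K).

(** What is known when the codes below k have been tried. *)
Definition best_so_far (k : nat) (s : state R) : Prop :=
  (nvar s 10 = 0%N /\
     forall k', (k' < k)%N -> ~ feas F G N (K := K) (cnd k')) \/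
  (nvar s 10 = 1%N /\ exists y, [/\ feas F G N (K := K) y,
     forall j : 'I_n, rarr s 27 j 0%N = y j 0,
     rarr s 26 0%N 0%N = dot c y &
     forall k', (k' < k)%N -> feas F G N (K := K) (cnd k') ->
       dot c y <= dot c (cnd k')]).

Lemma update_wp s k : agree W T s0 s ->
  holds_mx (proj (rowsel k) K) s ->
  nvar s 9 = all (row_ok (cnd k)) (iota 0 K) ->
  best_so_far k s -> wp (update cost_e) s (best_so_far k.+1).
Proof.
move=> a0 hP h9 hB; apply: wp_seq.
apply: (wp_cons _ _ _ _ (accum_dot _ _ _ _ Cm a0 hP _ _)) => //.
  move=> s3 a3; have a03 := agree_step _ _ _ _ _ _ _ a0 a3 isT isT.
  by rewrite CE.
move=> s1 a1; rewrite -/(cnd k) -/c => h1.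
have a01 := agree_step _ _ _ _ _ _ _ a0 a1 isT isT.
have hP1 : holds_mx (proj (rowsel k) K) s1 by move=> i j; rewrite a1.2 // hP.
have xN : reval s1 (coord hom_exp) = cnd k N 0.
  by apply: coordE => //=; rewrite (agree_dim _ a01) NE.
have xN1 : (1 <= cnd k N 0) = (cnd k N 0 == 1).
  rewrite /cnd /cand mxE; set z := proj _ _ N N.
  by have [->|z0] := eqVneq z 0; rewrite ?mul0r ?divff ?lexx ?eqxx //
    ler10 eq_sym oner_eq0.
have imp : beval s1 improves =
  `[< feas F G N (K := K) (cnd k) >] &&
  ~~ ((0 < nvar s 10)%N && (rarr s 26 0%N 0%N <= dot c (cnd k))).
  change (beval s1 improves) with
    ((0 < nvar s1 9)%N && (1 <= reval s1 (coord hom_exp)) &&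
     ~~ ((0 < nvar s1 10)%N && (rarr s1 26 0%N 0%N <= rarr s1 25 0%N 0%N))).
  rewrite xN xN1 (a1.1 9%N) // (a1.1 10%N) // (a1.2 26%N) // h1 h9 lt0b.
  congr (_ && _); rewrite andbC.
  apply/idP/asboolP => [/andP[/eqP h2 h3]|]; first by apply/feasE.
  by move/feasE => [-> ->]; rewrite eqxx.
apply: wp_if; case: ifPn; rewrite imp.
  move=> /andP[/asboolP fk hn].
  apply: wp_seq; apply: wp_nset; apply: wp_seq; apply: wp_rset.
  set s2 := set_rarr _ _ _ _ _.
  have a02 : agree W T s0 s2.
    split=> [v hv|t ht]; rewrite /= -?a01.1 -?a01.2 //.
      by case: eqP hv => // ->.
    apply/funext => i; apply/funext => j.
    by case: eqP ht => // ->.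
  have hP2 : holds_mx (proj (rowsel k) K) s2 by move=> i j; rewrite /= hP1.
  apply: (wp_cons _ _ _ _ (wp_fill _ _ _ _ _ _ _
    (fun i j => rarr s 20 i (8 * d)%N * (rarr s 20 (8 * d)%N (8 * d)%N)^-1)
      _ _ _ _)) => //.
    move=> i j s3 hi hj a3 hvi hvj _.
    rewrite /= hvi (a3.2 20%N) // (a3.1 1%N) //= (a1.1 1%N) // (agree_dim _ a0).
    by rewrite (a1.2 20%N).
  move=> s3 a3 h3; right; split; first by rewrite a3.1.
  exists (cnd k); split => //.
  - move=> j; rewrite h3 //; last by rewrite /= (a1.1 1%N) // (agree_dim _ a0).
    by rewrite !mxE -!hP NE.
  - by rewrite (a3.2 26%N) //= h1.
  - move=> k'; rewrite ltnS leq_eqVlt => /predU1P[->//|hk'] fk'.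
    case: hB => [[_ /(_ _ hk')]//|[h10 [y [_ _ hb hy]]]].
    move: hn; rewrite h10 /= -ltNge hb => /ltW h.
    by apply: le_trans h _; exact: hy.
rewrite negb_and negbK => hn; apply: wp_skip.
case: hB => [[h10 hB]|[h10 [y [fy hy hb ho]]]]; [left|right]; rewrite (a1.1 10%N) //.
  split=> // k'; rewrite ltnS leq_eqVlt => /predU1P[->|]; last exact: hB.
  by move: hn; rewrite h10 /= orbF => /asboolPn.
split=> //; exists y; split=> //.
- by move=> j; rewrite (a1.2 27%N).
- by rewrite (a1.2 26%N).
- move=> k'; rewrite ltnS leq_eqVlt => /predU1P[-> fk|]; last exact: ho.
  case/orP: hn; first by move=> /asboolPn.
  by rewrite h10 /= hb.
Qed.

Lemma search_wp :
  (forall r, (r < K)%N ->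
    G r = 0 \/ exists2 r', (r' < K)%N & G r = F r') ->
  (forall v : 'cV_n, v N 0 = 0 ->
    (forall r, (r < K)%N -> 0 <= dot (F r) v) -> v = 0) ->
  (exists2 y0, feas F G N (K := K) y0 &
    forall y, feas F G N (K := K) y -> dot c y0 <= dot c y) ->
  wp (search row_e partner_e cost_e) s0 (fun s => exists y,
    [/\ feas F G N (K := K) y,
    forall y', feas F G N (K := K) y' -> dot c y <= dot c y' &
    forall j : 'I_n, rarr s 27 j 0%N = y j 0]).
Proof.
move=> hG hF [y0 fy0 oy0]; apply: wp_seq; apply: wp_nset.
set s1 := set_nvar _ _ _.
have a01 : agree W T s0 s1 by exact: agree_nset.
apply: wp_seq; apply: (wp_for _ _ _ _ (fun k s' => nvar s' 4 = (2 ^ k)%N))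
  => //.
  move=> i s2 hi a2 hv h4; apply: wp_nset.
  by rewrite /= h4 expnSr.
move=> s2 a2 h4.
have a02 := agree_step _ _ _ _ _ _ _ a01 a2 isT isT.
apply: (wp_for _ _ _ _ best_so_far) => //.
- by left; split=> //; rewrite a2.1.
- move=> k s3 hk a3 hv hB.
  have a03 := agree_step _ _ _ _ _ _ _ a02 a3 isT isT.
  apply: wp_seq; apply: (wp_cons _ _ _ _ (candidate_wp _ a03)) => s4 a4.
  rewrite hv => hP4; have a04 := agree_step _ _ _ _ _ _ _ a03 a4 isT isT.
  apply: wp_seq; apply: (wp_cons _ _ _ _ (check_wp _ _ a04 hP4)) => s5 a5 h5.
  have a05 := agree_step _ _ _ _ _ _ _ a04 a5 isT isT.
  apply: update_wp => //; first by move=> i j; rewrite a5.2 // hP4.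
  case: hB => [[h10 hB]|[h10 [y [fy hy hb ho]]]]; [left|right];
    rewrite (a5.1 10%N) // (a4.1 10%N) //; split => //.
  exists y; split=> //; last by rewrite (a5.2 26%N) // (a4.2 26%N).
  by move=> j; rewrite (a5.2 27%N) // (a4.2 27%N).
- have -> : neval s2 (NVar 4) = (2 ^ K)%N by rewrite /= h4 /= s0d.
  move=> s3 a3 hB.
  have [k [hk fk ok]] := cand_opt F G c N hG hF y0 fy0 oy0.
  case: hB => [[_ /(_ _ hk)]//|[_ [y [fy hy _ ho]]]].
  exists y; split=> // y' fy'; apply: le_trans (ho _ hk fk) _.
  by apply: le_trans ok _; exact: oy0.
Qed.

End Search.

(** * The rows of the mixed integer program as expressions *)

Definition atleast (e1 e2 : nexp) : nexp := NSub (NLit 1) (NSub e1 e2).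

Fixpoint select (e : nexp) (k : nat) (es : seq rexp) : rexp :=
  if es is e1 :: es' then
    RAdd (RMul (kron e (NLit k)) e1) (select e k.+1 es')
  else RNat (NLit 0).

Definition block (k : nat) (i : nexp) : nexp :=
  NAdd (NMul (NLit k) (NVar 1)) i.

Definition rho0 : nexp := NMul (NLit 7) (NVar 1).

(** A point lists beta, g, h, eta1, eta2, eta3, eta4 and rho, where rho is
    filled up to length d, and then the homogeneous coordinate; [u k] is the
    coordinate i of block k.  The entries of this list, for i < d, are the three
    equations, the five multipliers eta1, ..., eta4, rho, and the five slacks
    complementary to them, in column c.  Reading outside the data yields 0, so
    a coordinate of rho added by the filling has slack 0 and does not enter the
    equations or the objective. *)
Definition rows (i c : nexp) : seq rexp :=
  let u k := kron c (block k i) in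
  let one := kron c hom_exp in
  let n := RNat (NVar 0) in
  let a := cell 0 in
  let lam := cell 1 in
  [:: RAdd (RGet 3 i c) (RAdd (u 3) (RAdd (ROpp (u 4))
        (RAdd (RMul (RNat (atleast rho0 c)) (RGet 5 i (NSub c rho0)))
              (RMul (RGet 4 i (NLit 0)) one))));
      RAdd (RMul (RMul n (RInv a)) (u 1))
        (RAdd (ROpp (RMul (RMul n (RInv a)) (u 2)))
              (RAdd (ROpp (u 5)) (u 6)));
      RAdd (ROpp (RMul n (RAdd (RMul (RInv a) (u 1)) (ROpp (RMul lam one)))))
        (RAdd (ROpp (u 3)) (ROpp (u 4)));
      u 3; u 4; u 5; u 6; u 7;
      RAdd (u 2) (ROpp (u 0));
      RAdd (u 2) (u 0);
      u 1;
      RAdd (RMul (RMul a lam) one) (ROpp (u 1));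
      RAdd (RMul (RGet 6 i (NLit 0)) one) (ROpp (RGet 5 c i))].

Definition row (r c : nexp) : rexp :=
  select (NDiv r (NVar 1)) 0 (rows (NMod r (NVar 1)) c).

Definition times (k : nat) : nexp := NMul (NLit k) (NVar 1).

(** Block t < 13 consists of the rows in position t of the list.  Block t + 10,
    for 3 <= t < 13, is M minus block t: it carries the upper bounds, which make
    the region bounded.  In a block t >= 13 the first summand is 0. *)
Definition mip_row_exp : rexp :=
  RAdd (row (NVar 6) (NVar 8))
    (RMul (RNat (atleast (times 13) (NVar 6)))
       (RAdd (RMul (cell 2) (kron (NVar 8) hom_exp))
             (ROpp (row (NSub (NVar 6) (times 10)) (NVar 8))))).

(** The partner of block t is block t itself for an equation, block t + 5 for a
    multiplier, and a block past the end of the list, hence 0, in all other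
    cases. *)
Definition mip_partner_exp : rexp :=
  row (NAdd (NVar 6)
        (NAdd (NMul (atleast (times 3) (NVar 6)) (times 5))
              (NMul (atleast (times 8) (NVar 6)) (times 13)))) (NVar 8).

Definition mip_cost_exp : rexp :=
  RMul (RInv (RNat (NLit 2)))
    (RAdd (RGet 4 (NVar 8) (NLit 0))
    (RAdd (ROpp (RMul (RNat (atleast rho0 (NVar 8)))
                   (RGet 6 (NSub (NVar 8) rho0) (NLit 0))))
    (RAdd (ROpp (RMul (RMul (cell 0) (cell 1))
                   (kron (NDiv (NVar 8) (NVar 1)) (NLit 6))))
          (RMul (RMul (cell 1) (RNat (NVar 0)))
             (kron (NDiv (NVar 8) (NVar 1)) (NLit 2)))))).

(** Arrays 7 to 14 receive the blocks 0 to 7 of the best point, and arrays 15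
    to 19 the quotients phi / phi for the multipliers phi, blocks 3 to 7. *)
Definition out_exp (t : nat) : rexp :=
  let e k := RGet 27 (block k (NVar 7)) (NLit 0) in
  if (t < 15)%N then e (t - 7)%N
  else RMul (e (t - 12)%N) (RInv (e (t - 12)%N)).

Fixpoint output (ts : seq nat) : cmd :=
  if ts is t :: ts' then
    Seq (fill t 7 (NVar 1) 8 (NLit 1) (out_exp t)) (output ts')
  else Skip.

Definition solver : cmd :=
  Seq (search mip_row_exp mip_partner_exp mip_cost_exp) (output (iota 7 13)).

Section Eval.
Context {R : realType}.
Implicit Type s : state R.

Lemma kronE s e1 e2 :
  reval s (kron e1 e2) = (neval s e1 == neval s e2)%:R.
Proof.
by rewrite /=; congr (_%:R); case: eqP => [->|]; lia.
Qed.

Lemma atleastE s e1 e2 :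
  neval s (atleast e1 e2) = (neval s e1 <= neval s e2)%N.
Proof. by rewrite /=; case: leqP; lia. Qed.

Lemma selectE s e k es : reval s (select e k es) =
  if (k <= neval s e)%N then nth 0 (map (reval s) es) (neval s e - k) else 0.
Proof.
elim: es k => [|e1 es IH] k; first by rewrite nth_nil if_same.
have -> : reval s (select e k (e1 :: es)) =
  reval s (kron e (NLit k)) * reval s e1 + reval s (select e k.+1 es) by [].
rewrite kronE IH [neval s (NLit k)]/=.
case: ltngtP => [h|h|->]; first by rewrite mul0r add0r -(subnSK h).
  by rewrite mul0r addr0.
by rewrite mul1r addr0 subnn.
Qed.

Lemma warrs_output ts : warrs (output ts) = ts.
Proof. by elim: ts => //= t ts ->. Qed.

Definition out_val (d : nat) (b : nat -> R) (t i : nat) : R :=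
  if (t < 15)%N then b ((t - 7) * d + i)%N
  else b ((t - 12) * d + i)%N / b ((t - 12) * d + i)%N.

Lemma output_wp d ts s : nvar s 1 = d -> uniq ts -> 27%N \notin ts ->
  wp (output ts) s (fun s' => forall t i, t \in ts -> (i < d)%N ->
    rarr s' t i 0%N = out_val d (fun j => rarr s 27 j 0%N) t i).
Proof.
elim: ts s => [|t ts IH] s sd; first by move=> _ _; apply: wp_skip.
rewrite /= inE negb_or => /andP[tts uts] /andP[t27 ts27].
apply: wp_seq; apply: (wp_cons _ _ _ _ (wp_fill _ _ _ _ _ _ _
   (fun i j => out_val d (fun j => rarr s 27 j 0%N) t i) _ _ _ _)) => //.
  move=> i j s1 hi hj a1 hvi hvj _.
  by rewrite /out_exp /out_val; case: ifP => _;
    rewrite /= hvi (a1.1 1%N) // sd a1.2 ?inE.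
move=> s1 a1 h1.
have sd1 : nvar s1 1 = d by rewrite a1.1.
apply: (wp_cons _ _ _ _ (IH _ sd1 uts ts27)) => s2 a2 h2 t' i.
rewrite inE => /predU1P[->|ht'] hi.
  by rewrite a2.2 ?warrs_output // h1 //= sd.
by rewrite h2 // a1.2 ?inE.
Qed.

End Eval.

(** * Meaning of the rows *)

Section Window.
Context {R : realType} {n : nat}.
Variable Y : nat -> R.

Definition lin (f : nat -> R) : R := \sum_(j < n) f j * Y j.

Lemma linD f g : lin (fun j => f j + g j) = lin f + lin g.
Proof. by rewrite -big_split /=; apply: eq_bigr => j _; rewrite mulrDl. Qed.

Lemma linN f : lin (fun j => - f j) = - lin f.
Proof. by rewrite -sumrN; apply: eq_bigr => j _; rewrite mulNr. Qed.

Lemma linZ a f : lin (fun j => a * f j) = a * lin f.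
Proof. by rewrite mulr_sumr; apply: eq_bigr => j _; rewrite mulrA. Qed.

Lemma lin_unit k : (k < n)%N -> lin (fun j => (j == k)%:R) = Y k.
Proof.
move=> hk; rewrite /lin (bigD1 (Ordinal hk)) //= eqxx mul1r big1 ?addr0 //.
by move=> j; rewrite -val_eqE /= => /negbTE ->; rewrite mul0r.
Qed.

(** Data arrays vanish outside their bounds, so the sum over all coordinates
    reduces to the block on which the data live. *)
Lemma lin_window f lo k : (lo + k <= n)%N ->
  (forall j, (j < n)%N -> ~~ (lo <= j < lo + k)%N -> f j = 0) ->
  lin f = \sum_(i < k) f (lo + i)%N * Y (lo + i)%N.
Proof.
move=> hk hf; rewrite /lin.
rewrite -(big_mkord xpredT (fun j => f j * Y j)).
rewrite (big_cat_nat (n := lo)) //=; last by lia.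
rewrite (big_cat_nat (m := lo) (n := (lo + k)%N)) //=; last by lia.
rewrite big_nat big1 ?add0r; last first.
  by move=> j hj; rewrite hf ?mul0r //; lia.
rewrite [X in _ + X]big_nat [X in _ + X]big1 ?addr0; last first.
  by move=> j hj; rewrite hf ?mul0r //; lia.
rewrite -[in LHS](add0n lo) big_addn add0n addKn.
by rewrite big_mkord; apply: eq_bigr => i _; rewrite addnC.
Qed.

Lemma eq_lin f g : (forall j, (j < n)%N -> f j = g j) -> lin f = lin g.
Proof. by move=> h; apply: eq_bigr => j _; rewrite h. Qed.

End Window.

Lemma block_lt d t i : (t < 8)%N -> (i < d)%N -> (t * d + i < 8 * d + 1)%N.
Proof.
move=> ht hi; have : (t.+1 * d <= 8 * d)%N by rewrite leq_mul2r ht orbT.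
by rewrite mulSn; lia.
Qed.

(** Every row index is t d + i for a block t and an index i < d. *)
Lemma blockwise d (P : nat -> Prop) k : (0 < d)%N ->
  (forall r, (r < k * d)%N -> P r) <->
  (forall t i, (t < k)%N -> (i < d)%N -> P (t * d + i)%N).
Proof.
move=> d0; split=> [h t i ht hi|h r hr].
  apply: h; have : (t.+1 * d <= k * d)%N by rewrite leq_mul2r ht orbT.
  by rewrite mulSn; lia.
by rewrite (divn_eq r d); apply: h; rewrite ?ltn_divLR ?ltn_mod.
Qed.

Lemma homog_lt d : (8 * d < 8 * d + 1)%N.
Proof. by rewrite addn1. Qed.

Definition homog d : 'I_(8 * d + 1) := Ordinal (homog_lt d).

Lemma mx_arrayE (R : realType) k l (B : 'M[R]_(k, l)) (i : 'I_k) (j : 'I_l) :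
  mx_array B i j = B i j.
Proof. by rewrite /mx_array !valK. Qed.

Lemma mx_array_row (R : realType) k l (B : 'M[R]_(k, l)) i j :
  (k <= i)%N -> mx_array B i j = 0.
Proof. by move=> h; rewrite /mx_array insubN // -leqNgt. Qed.

Lemma mx_array_col (R : realType) k l (B : 'M[R]_(k, l)) i j :
  (l <= j)%N -> mx_array B i j = 0.
Proof.
by move=> h; rewrite /mx_array; case: insub => // i'; rewrite insubN // -leqNgt.
Qed.

Section Instance.
Context {R : realType} {d m : nat}.
Variables (D : mcp_data R d m) (M : R).
Hypothesis d0 : (0 < d)%N.
Hypothesis md : (m < d)%N.

Let n := (8 * d + 1)%N.
Local Notation lin := (@lin R n).

(** A state that holds the instance, the row in variable 6 and the column in
    variable 8: nothing else influences the entries of the rows. *)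
Definition loop_state (r c : nat) : state R :=
  State (fun v => if v == 6%N then r else if v == 8%N then c
                  else nvar (load D M) v)
        (rarr (load D M)).

Let Fm r c := reval (loop_state r c) mip_row_exp.
Let Gm r c := reval (loop_state r c) mip_partner_exp.
Let Cm c := reval (loop_state 0 c) mip_cost_exp.

Definition row_val (t i j : nat) : R :=
  nth 0 (map (reval (loop_state 0 j)) (rows (NLit i) (NVar 8))) t.

Lemma reval_row er r j : reval (loop_state r j) (row er (NVar 8)) =
  row_val (neval (loop_state r j) er %/ d) (neval (loop_state r j) er %% d) j.
Proof.
by rewrite /row selectE /= subn0.
Qed.

Lemma mip_row_entry t i j : (i < d)%N -> Fm (t * d + i) j =
  if (t < 13)%N then row_val t i j
  else M * (j == 8 * d)%N%:R - row_val (t - 10) i j.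
Proof.
move=> hi; rewrite /Fm /mip_row_exp.
set r := (t * d + i)%N; set s := loop_state r j.
have -> : reval s (RAdd (row (NVar 6) (NVar 8))
   (RMul (RNat (atleast (times 13) (NVar 6)))
      (RAdd (RMul (cell 2) (kron (NVar 8) hom_exp))
         (ROpp (row (NSub (NVar 6) (times 10)) (NVar 8)))))) =
  reval s (row (NVar 6) (NVar 8)) + (neval s (atleast (times 13) (NVar 6)))%:R *
   (reval s (cell 2) * reval s (kron (NVar 8) hom_exp) -
    reval s (row (NSub (NVar 6) (times 10)) (NVar 8))) by [].
rewrite kronE atleastE !reval_row.
have -> : reval s (cell 2) = M.
  by rewrite /= (mx_arrayE _ _ _ _ ord0 ord0) mxE.
have -> : neval s (NVar 6) = r by [].
have -> : neval s (NSub (NVar 6) (times 10)) = (r - 10 * d)%N by [].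
have -> : neval s (NVar 8) = j by [].
have -> : neval s hom_exp = (8 * d)%N by [].
have -> : neval s (times 13) = (13 * d)%N by [].
have e1 : (r %/ d)%N = t by rewrite divnMDl // divn_small // addn0.
have e2 : (r %% d)%N = i by rewrite modnMDl modn_small.
rewrite e1 e2; have -> : (13 * d <= r)%N = (13 <= t)%N.
  by rewrite -e1 leq_divRL.
case: (ltnP t 13) => ht /=; first by rewrite mul0r addr0.
have -> : (r - 10 * d)%N = ((t - 10) * d + i)%N.
  by rewrite /r mulnBl; have : (10 * d <= t * d)%N; [rewrite leq_mul2r; lia | lia].
rewrite divnMDl // divn_small // addn0 modnMDl modn_small // mul1r.
by rewrite {1}/row_val nth_default ?add0r.
Qed.

Lemma mip_partner_entry t i j : (i < d)%N -> Gm (t * d + i) j =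
  if (t < 3)%N then row_val t i j
  else if (t < 8)%N then row_val (t + 5) i j else 0.
Proof.
move=> hi; rewrite /Gm /mip_partner_exp reval_row.
set s := loop_state _ j.
have -> e1 e2 e3 :
  neval s (NAdd e1 (NAdd (NMul e2 (times 5)) (NMul e3 (times 13)))) =
  (neval s e1 + (neval s e2 * (5 * d) + neval s e3 * (13 * d)))%N by [].
rewrite !atleastE.
have -> : neval s (NVar 6) = (t * d + i)%N by [].
have -> k : neval s (times k) = (k * d)%N by [].
have e k : (k * d <= t * d + i)%N = (k <= t)%N.
  by rewrite -leq_divRL // divnMDl // divn_small // addn0.
have f k : (((k * d + i) %/ d)%N = k) * (((k * d + i) %% d)%N = i).
  by split; rewrite ?divnMDl ?divn_small ?addn0 ?modnMDl ?modn_small.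
rewrite !e; case: (ltnP t 3) => h3.
  by rewrite (leqNgt 8) (ltn_trans h3) // !mul0n !addn0 !f.
rewrite mul1n; case: (ltnP t 8) => h8; first by rewrite addn0 addnAC -mulnDl !f.
rewrite mul1n -mulnDl addnAC -mulnDl !f /row_val nth_default //=; lia.
Qed.

Definition form (Y : nat -> R) (t i : nat) : R := lin Y (row_val t i).

Let A' := mx_array (Amat D).
Let b' i := mx_array (bvec D) i 0.
Let q' i := mx_array (qvec D) i 0.
Let Q' := mx_array (Qmat D).
Let nR : R := (smp D)%:R.
Let a := thr D.
Let l := lam D.

Lemma formE Y i : (i < d)%N ->
  let u t := Y (t * d + i)%N in
  let w := Y (8 * d)%N in
  [/\ form Y 0 i = \sum_(j < d) Q' i j * Y j + u 3 - u 4 +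
        \sum_(k < m) A' i k * Y (7 * d + k)%N + q' i * w,
      form Y 1 i = nR / a * u 1 - nR / a * u 2 - u 5 + u 6 &
      form Y 2 i = - (nR * (a^-1 * u 1 - l * w)) - u 3 - u 4] /\
  [/\ form Y 3 i = u 3, form Y 4 i = u 4, form Y 5 i = u 5, form Y 6 i = u 6
    & form Y 7 i = u 7] /\
  [/\ form Y 8 i = u 2 - u 0, form Y 9 i = u 2 + u 0, form Y 10 i = u 1,
      form Y 11 i = a * l * w - u 1
    & form Y 12 i = b' i * w - \sum_(j < d) A' j i * Y j].
Proof.
move=> hi u w.
have hu t : (t < 8)%N -> lin Y (fun j => (j == t * d + i)%N%:R) = u t.
  move=> ht; apply: lin_unit; rewrite /n.
  have : (t.+1 * d <= 8 * d)%N by rewrite leq_mul2r ht orbT.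
  by rewrite mulSn; lia.
have hw : lin Y (fun j => (j == 8 * d)%N%:R) = w.
  by apply: lin_unit; rewrite /n addn1.
have cellE t j : (t < 3)%N ->
      reval (loop_state 0 j) (cell t) = nth 0 [:: a; l; M] t.
  by case: t => [|[|[|t]]] // _; rewrite /= (mx_arrayE _ _ _ _ ord0 ord0) mxE.
have rv t j : row_val t i j = nth 0 [::
   Q' i j + ((j == 3 * d + i)%N%:R + (- (j == 4 * d + i)%N%:R +
      ((7 * d <= j)%N%:R * A' i (j - 7 * d)%N + q' i * (j == 8 * d)%N%:R)));
   nR / a * (j == 1 * d + i)%N%:R + (- (nR / a * (j == 2 * d + i)%N%:R) +
     (- (j == 5 * d + i)%N%:R + (j == 6 * d + i)%N%:R));
   - (nR * (a^-1 * (j == 1 * d + i)%N%:R - l * (j == 8 * d)%N%:R)) +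
     (- (j == 3 * d + i)%N%:R - (j == 4 * d + i)%N%:R);
   (j == 3 * d + i)%N%:R; (j == 4 * d + i)%N%:R; (j == 5 * d + i)%N%:R;
   (j == 6 * d + i)%N%:R; (j == 7 * d + i)%N%:R;
   (j == 2 * d + i)%N%:R - (j == 0 * d + i)%N%:R;
   (j == 2 * d + i)%N%:R + (j == 0 * d + i)%N%:R;
   (j == 1 * d + i)%N%:R;
   a * l * (j == 8 * d)%N%:R - (j == 1 * d + i)%N%:R;
   b' i * (j == 8 * d)%N%:R - A' j i] t.
  rewrite /row_val /rows; set s := loop_state 0 j.
  have ku k :
      reval s (kron (NVar 8) (block k (NLit i))) = (j == k * d + i)%N%:R.
    by rewrite kronE.
  have kw : reval s (kron (NVar 8) hom_exp) = (j == 8 * d)%N%:R.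
    by rewrite kronE.
  have kr : neval s (atleast rho0 (NVar 8)) = (7 * d <= j)%N.
    by rewrite atleastE.
  by cbn [map reval]; rewrite !ku !kw !kr !cellE.
have eform t f : (forall j, row_val t i j = f j) -> form Y t i = lin Y f.
  by move=> h; apply: eq_lin => j _; exact: h.
have hQ : lin Y (Q' i) = \sum_(j < d) Q' i j * Y j.
  rewrite (lin_window _ _ 0 d) //; first by rewrite /n; lia.
  by move=> j _ hj; rewrite /Q' mx_array_col //; lia.
have hA : lin Y (fun j => A' j i) = \sum_(j < d) A' j i * Y j.
  rewrite (lin_window _ _ 0 d) //; first by rewrite /n; lia.
  by move=> j _ hj; rewrite /A' mx_array_row //; lia.
have hAr : lin Y (fun j => (7 * d <= j)%N%:R * A' i (j - 7 * d)%N) =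
    \sum_(k < m) A' i k * Y (7 * d + k)%N.
  rewrite (lin_window _ _ (7 * d) m); first last.
  - move=> j _ hj; case: leqP => h; last by rewrite mul0r.
    by rewrite /A' mx_array_col ?mulr0 //; lia.
  - by rewrite /n; lia.
  by apply: eq_bigr => k _; rewrite leq_addr mul1r addKn.
do !split; rewrite (eform _ _ (rv _)) /= ?(linD, linN, linZ, hQ, hA, hAr, hw)
  ?hu // ?addrA //.
Qed.

Definition decode (Y : nat -> R) : cont_vars R d m :=
  let u t : 'cV[R]_d := \col_i Y (t * d + i)%N in
  ContVars (u 0) (u 1) (u 2) (u 3) (u 4) (u 5) (u 6)
    (\col_i Y (7 * d + i)%N).

Definition mip_row r : 'cV[R]_n := \col_j Fm r j.
Definition mip_partner r : 'cV[R]_n := \col_j Gm r j.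
Definition mip_cost : 'cV[R]_n := \col_j Cm j.

Definition coords (y : 'cV[R]_n) j := mx_array y j 0.

Lemma dot_coords (f : nat -> R) (y : 'cV[R]_n) :
  dot (\col_(j < n) f j) y = lin (coords y) f.
Proof.
rewrite dotE; apply: eq_bigr => j _.
by rewrite mxE /coords (mx_arrayE _ _ _ _ _ ord0).
Qed.

Lemma dot_mip_row y t i : (i < d)%N -> dot (mip_row (t * d + i)) y =
  if (t < 13)%N then form (coords y) t i
  else M * coords y (8 * d) - form (coords y) (t - 10) i.
Proof.
move=> hi; rewrite dot_coords; under eq_lin => j _ do rewrite mip_row_entry //.
case: ifP => // _; rewrite linD linN linZ lin_unit //.
by rewrite /n addn1.
Qed.

Lemma dot_mip_partner y t i : (i < d)%N -> dot (mip_partner (t * d + i)) y =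
  if (t < 3)%N then form (coords y) t i
  else if (t < 8)%N then form (coords y) (t + 5) i else 0.
Proof.
move=> hi; rewrite dot_coords; under eq_lin => j _ do rewrite mip_partner_entry //.
case: ifP => // _; case: ifP => // _.
by rewrite /lin big1 // => j _; rewrite mul0r.
Qed.

Lemma dot_mip_cost y : dot mip_cost y = objective D (decode (coords y)).
Proof.
rewrite dot_coords /objective.
set Y := coords y; set s := loop_state 0.
have cellE t j : (t < 3)%N -> reval (s j) (cell t) = nth 0 [:: a; l; M] t.
  by case: t => [|[|[|t]]] // _; rewrite /= (mx_arrayE _ _ _ _ ord0 ord0) mxE.
have e j : Cm j = 2^-1 * (q' j + (- ((7 * d <= j)%N%:R * b' (j - 7 * d)%N) +
   (- (a * l * (j %/ d == 6)%N%:R) + l * nR * (j %/ d == 2)%N%:R))).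
  rewrite /Cm /mip_cost_exp -/(s j).
  have ku k : reval (s j) (kron (NDiv (NVar 8) (NVar 1)) (NLit k)) =
    (j %/ d == k)%N%:R by rewrite kronE.
  have kr : neval (s j) (atleast rho0 (NVar 8)) = (7 * d <= j)%N.
    by rewrite atleastE.
  by cbn [reval]; rewrite !ku !kr !cellE.
under eq_lin => j _ do rewrite e.
rewrite linZ !(linD, linN, linZ).
have hq : lin Y q' = dot (qvec D) (beta (decode Y)).
  rewrite (lin_window _ _ 0 d); first last.
  - by move=> j _ hj; rewrite /q' mx_array_row //; lia.
  - by rewrite /n; lia.
  by rewrite dotE; apply: eq_bigr => i _; rewrite /q' (mx_arrayE _ _ _ _ _ ord0) mxE.
have hb : lin Y (fun j => (7 * d <= j)%N%:R * b' (j - 7 * d)%N) =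
    dot (bvec D) (rho (decode Y)).
  rewrite (lin_window _ _ (7 * d) m); first last.
  - move=> j _ hj; case: leqP => h; last by rewrite mul0r.
    by rewrite /b' mx_array_row ?mulr0 //; lia.
  - by rewrite /n; lia.
  rewrite dotE; apply: eq_bigr => i _.
  by rewrite leq_addr mul1r addKn /b' (mx_arrayE _ _ _ _ _ ord0) mxE.
have hu k : (k < 8)%N -> lin Y (fun j => (j %/ d == k)%N%:R) =
    dot (ones d) (\col_i Y (k * d + i)%N).
  move=> hk; have hkd : (k.+1 * d <= 8 * d)%N by rewrite leq_mul2r hk orbT.
  rewrite (lin_window _ _ (k * d) d); first last.
  - move=> j _ hj; case: eqP => // jk; case/negP: hj.
    rewrite {1 2}(divn_eq j d) jk leq_addr /= ltn_add2l ltn_mod //.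
  - by move: hkd; rewrite /n mulSn; lia.
  rewrite dotE; apply: eq_bigr => i _.
  by rewrite divnMDl // divn_small // addn0 eqxx !mxE.
rewrite hq hb !hu //= -/a -/l; ring.
Qed.

Lemma form_decode Y : Y (8 * d)%N = 1 -> let x := decode Y in
  (forall i : 'I_d,
  [/\ form Y 0 i = (qvec D + Qmat D *m beta x + eta1 x - eta2 x
                     + Amat D *m rho x) i 0,
      form Y 1 i = ((nR / a) *: gg x - (nR / a) *: hh x - eta3 x + eta4 x) i 0 &
      form Y 2 i = (- (nR *: (a^-1 *: gg x - l *: ones d)) - eta1 x - eta2 x) i 0] /\
  [/\ form Y 3 i = eta1 x i 0, form Y 4 i = eta2 x i 0,
      form Y 5 i = eta3 x i 0 & form Y 6 i = eta4 x i 0] /\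
  [/\ form Y 8 i = (hh x - beta x) i 0, form Y 9 i = (hh x + beta x) i 0,
      form Y 10 i = gg x i 0 &
      form Y 11 i = ((a * l) *: ones d - gg x) i 0]) /\
  (forall i : 'I_m, form Y 7 i = rho x i 0 /\
     form Y 12 i = (bvec D - (Amat D)^T *m beta x) i 0).
Proof.
move=> w1 x; split=> i.
  have [[f0 f1 f2] [[f3 f4 f5 f6 f7] [f8 f9 f10 f11 f12]]] :=
    formE Y i (ltn_ord i).
  rewrite f0 f1 f2 f3 f4 f5 f6 f8 f9 f10 f11 w1 !mulr1.
  do !split; rewrite !mxE ?mulr1 //.
  have -> : \sum_j Qmat D i j * beta x j 0 = \sum_(j < d) Q' i j * Y j.
    by apply: eq_bigr => j _; rewrite mxE /Q' mx_arrayE.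
  have -> : \sum_j Amat D i j * rho x j 0 =
      \sum_(k < m) A' i k * Y (7 * d + k)%N.
    by apply: eq_bigr => j _; rewrite mxE /A' mx_arrayE.
  by rewrite /q' (mx_arrayE _ _ _ _ _ ord0); ring.
have hi : (i < d)%N by apply: ltn_trans (ltn_ord i) md.
have [_ [[_ _ _ _ f7] [_ _ _ _ f12]]] := formE Y i hi.
rewrite f7 f12 w1 mulr1; split; rewrite !mxE //.
rewrite /b' (mx_arrayE _ _ _ _ _ ord0); congr (_ - _).
by apply: eq_bigr => j _; rewrite !mxE /A' mx_arrayE.
Qed.

Local Notation feas_mip := (feas (K := 23 * d) mip_row mip_partner (homog d)).

Lemma coords_homog y : coords y (8 * d) = y (homog d) 0.
Proof. by rewrite /coords (mx_arrayE _ _ _ _ (homog d) ord0). Qed.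

Lemma feas_forms y : feas_mip y <-> coords y (8 * d) = 1 /\
  forall i, (i < d)%N ->
  [/\ forall t, (t < 3)%N -> form (coords y) t i = 0,
      forall t, (3 <= t < 13)%N -> 0 <= form (coords y) t i <= M &
      forall t, (3 <= t < 8)%N -> form (coords y) t i * form (coords y) (t + 5) i = 0].
Proof.
rewrite /feas -coords_homog (blockwise d (fun r =>
  0 <= dot (mip_row r) y /\ dot (mip_row r) y * dot (mip_partner r) y = 0) _ d0).
split=> -[hw h]; split=> //.
  move=> i hi; split=> t ht.
  - have ht' : (t < 23)%N by lia.
    have [_] := h t i ht' hi; rewrite dot_mip_row // dot_mip_partner // ht.
    have -> : (t < 13)%N by lia.
    by move/eqP; rewrite mulf_eq0 orbb => /eqP.
  - have ht' : (t < 23)%N by lia.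
    have ht2 : (t + 10 < 23)%N by lia.
    have [h1 _] := h t i ht' hi; have [h2 _] := h _ i ht2 hi.
    move: h1 h2; rewrite !dot_mip_row //.
    have -> : (t < 13)%N by lia.
    have -> : (t + 10 < 13)%N = false by lia.
    by rewrite addnK hw mulr1 subr_ge0 => -> ->.
  - have ht' : (t < 23)%N by lia.
    have [_] := h t i ht' hi; rewrite dot_mip_row // dot_mip_partner //.
    have -> : (t < 13)%N by lia.
    have -> : (t < 3)%N = false by lia.
    by have -> : (t < 8)%N by lia.
move=> t i ht hi; have [h1 h2 h3] := h i hi; rewrite dot_mip_row // dot_mip_partner //.
case: (ltnP t 3) => t3.
  have -> : (t < 13)%N by lia.
  by rewrite h1 // mulr0 lexx.
case: (ltnP t 13) => t13.
  have t3' : (3 <= t < 13)%N by rewrite t3.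
  have /andP[h4 _] := h2 t t3'; split=> //.
  by case: (ltnP t 8) => t8; rewrite ?mulr0 // h3 // t3.
rewrite hw mulr1 subr_ge0.
have -> : (t < 8)%N = false by lia.
rewrite mulr0; split=> //.
have t3' : (3 <= t - 10 < 13)%N by lia.
by have /andP[] := h2 _ t3'.
Qed.

Lemma feas_decode y : feas_mip y -> let x := decode (coords y) in
  [/\ equalities D x, complementarities D x & entries_le D M x].
Proof.
move=> /feas_forms[w1 h] x; have [fd fm] := form_decode _ w1.
have md' (i : 'I_m) : (i < d)%N by apply: ltn_trans (ltn_ord i) md.
have pair k (phi delta : 'cV[R]_k) t : (3 <= t < 8)%N ->
    (forall i : 'I_k, [/\ (i < d)%N, form (coords y) t i = phi i 0
       & form (coords y) (t + 5) i = delta i 0]) ->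
    [/\ perp phi delta, lev phi (M *: ones k) & lev delta (M *: ones k)].
  move=> ht hf.
  have t1 : (3 <= t < 13)%N by lia.
  have t2 : (3 <= t + 5 < 13)%N by lia.
  have hi (i : 'I_k) : [/\ 0 <= phi i 0 <= M, 0 <= delta i 0 <= M
      & phi i 0 * delta i 0 = 0].
    have [hi <- <-] := hf i; have [_ h2 h3] := h i hi.
    by split; [exact: h2 | exact: h2 | exact: h3].
  split; [split|..] => i; have [/andP[p1 p2] /andP[d1 d2] pd] := hi i;
    by rewrite ?mxE ?mulr1.
have [p3 u3 v3] : [/\ perp (eta1 x) (hh x - beta x),
    lev (eta1 x) (M *: ones d) & lev (hh x - beta x) (M *: ones d)].
  by apply: (pair _ _ _ 3) => // i; have [_ [[? ? ? ?] [? ? ? ?]]] := fd i; split.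
have [p4 u4 v4] : [/\ perp (eta2 x) (hh x + beta x),
    lev (eta2 x) (M *: ones d) & lev (hh x + beta x) (M *: ones d)].
  by apply: (pair _ _ _ 4) => // i; have [_ [[? ? ? ?] [? ? ? ?]]] := fd i; split.
have [p5 u5 v5] : [/\ perp (eta3 x) (gg x),
    lev (eta3 x) (M *: ones d) & lev (gg x) (M *: ones d)].
  by apply: (pair _ _ _ 5) => // i; have [_ [[? ? ? ?] [? ? ? ?]]] := fd i; split.
have [p6 u6 v6] : [/\ perp (eta4 x) ((a * l) *: ones d - gg x),
    lev (eta4 x) (M *: ones d) & lev ((a * l) *: ones d - gg x) (M *: ones d)].
  by apply: (pair _ _ _ 6) => // i; have [_ [[? ? ? ?] [? ? ? ?]]] := fd i; split.
have [p7 u7 v7] : [/\ perp (rho x) (bvec D - (Amat D)^T *m beta x),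
    lev (rho x) (M *: ones m)
    & lev (bvec D - (Amat D)^T *m beta x) (M *: ones m)].
  by apply: (pair _ _ _ 7) => // i; have [? ?] := fm i; split.
split=> //; split; apply/colP => i; have [[e0 e1 e2] _] := fd i;
  have [h1 _ _] := h i (ltn_ord i); rewrite [RHS]mxE.
- by rewrite -e0 h1.
- by rewrite -e1 h1.
- by rewrite -e2 h1.
Qed.

Definition flat (x : cont_vars R d m) (j : nat) : R :=
  let u k (v : 'cV[R]_k) := mx_array v (j %% d) 0 in
  nth 1 [:: u d (beta x); u d (gg x); u d (hh x); u d (eta1 x); u d (eta2 x);
            u d (eta3 x); u d (eta4 x); u m (rho x)] (j %/ d).

Definition encode x : 'cV[R]_n := \col_j flat x j.

Lemma flatE x t i : (i < d)%N -> flat x (t * d + i) =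
  let u k (v : 'cV[R]_k) := mx_array v i 0 in
  nth 1 [:: u d (beta x); u d (gg x); u d (hh x); u d (eta1 x); u d (eta2 x);
            u d (eta3 x); u d (eta4 x); u m (rho x)] t.
Proof.
by move=> hi; rewrite /flat divnMDl // divn_small // addn0 modnMDl modn_small.
Qed.

Lemma coords_encode x j : (j < n)%N -> coords (encode x) j = flat x j.
Proof.
by move=> hj; rewrite /coords (mx_arrayE _ _ _ _ (Ordinal hj) ord0) mxE.
Qed.

Lemma decode_encode x : decode (coords (encode x)) = x.
Proof.
have md' (i : 'I_m) : (i < d)%N by apply: ltn_trans (ltn_ord i) md.
rewrite /decode; case: x => x0 x1 x2 x3 x4 x5 x6 x7.
by congr ContVars; apply/colP => i; rewrite mxE coords_encode ?block_lt // flatE //=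
  (mx_arrayE _ _ _ _ _ ord0).
Qed.

(** The coordinates of rho beyond m are 0, and the bound M is nonnegative
    because it bounds a nonnegative entry. *)
Lemma feas_encode x : equalities D x -> complementarities D x ->
  entries_le D M x -> feas_mip (encode x).
Proof.
move=> [E1 E2 E3] [c1 c2 c3 c4 c5] [[u1 u2 u3 u4 u5] [v1 v2] v3 v4 v5].
have M0 : 0 <= M.
  case: c1 => /(_ (Ordinal d0)) + _ _; rewrite mxE => /le_trans; apply.
  by have := u1 (Ordinal d0); rewrite !mxE mulr1.
set y := encode x.
have w1 : coords y (8 * d) = 1.
  rewrite coords_encode; last by rewrite /n addn1.
  by have := flatE x 8 0 d0; rewrite addn0.
apply/feas_forms; split=> // i hi.
have [fd fm] := form_decode _ w1; rewrite decode_encode in fd fm.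
have [[e0 e1 e2] [[f3 f4 f5 f6] [f8 f9 f10 f11]]] := fd (Ordinal hi).
have pair k (phi delta : 'cV[R]_k) (j : 'I_k) f g : perp phi delta ->
    lev phi (M *: ones k) -> lev delta (M *: ones k) ->
    f = phi j 0 -> g = delta j 0 ->
    [/\ 0 <= f <= M, 0 <= g <= M & f * g = 0].
  move=> [h1 h2 h3] h4 h5 -> ->; split; last exact: h3.
    by have := h1 j; have := h4 j; rewrite !mxE mulr1 => -> ->.
  by have := h2 j; have := h5 j; rewrite !mxE mulr1 => -> ->.
have [p3 q3 r3] := pair _ _ _ _ _ _ c1 u1 v1 f3 f8.
have [p4 q4 r4] := pair _ _ _ _ _ _ c2 u2 v2 f4 f9.
have [p5 q5 r5] := pair _ _ _ _ _ _ c3 u3 v3 f5 f10.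
have [p6 q6 r6] := pair _ _ _ _ _ _ c4 u4 v4 f6 f11.
have [p7 q7 r7] : [/\ 0 <= form (coords y) 7 i <= M, 0 <= form (coords y) 12 i <= M &
   form (coords y) 7 i * form (coords y) 12 i = 0].
  have [im|im] := ltnP i m.
    have [f7 f12] := fm (Ordinal im).
    exact: (pair _ _ _ _ _ _ c5 u5 v5 f7 f12).
  have [_ [[_ _ _ _ ->] [_ _ _ _ ->]]] := formE (coords y) i hi.
  have -> : coords y (7 * d + i) = 0.
    rewrite coords_encode ?block_lt //.
    by rewrite flatE //= mx_array_row.
  rewrite /b' mx_array_row // mul0r big1 ?subrr ?lexx ?mulr0 //.
  by move=> j _; rewrite /A' mx_array_col // mul0r.
have z (v : 'cV[R]_d) (f : R) : f = v (Ordinal hi) 0 -> v = 0 -> f = 0.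
  by move=> -> ->; rewrite mxE.
have z0 := z _ _ e0 E1; have z1 := z _ _ e1 E2; have z2 := z _ _ e2 E3.
split; first by case=> [|[|[|]]].
  by do 13 (case=> //).
by do 8 (case=> //).
Qed.

(** For a direction the upper bound rows read - form >= 0, so that all
    multipliers and slacks vanish.  Then g = 0, and h - beta = h + beta = 0
    gives h = beta = 0. *)
Lemma mip_pointed (v : 'cV[R]_n) : v (homog d) 0 = 0 ->
  (forall r, (r < 23 * d)%N -> 0 <= dot (mip_row r) v) -> v = 0.
Proof.
rewrite -coords_homog => w0 /(blockwise d (fun r => 0 <= dot (mip_row r) v) _ d0) h.
have zero t i : (3 <= t < 13)%N -> (i < d)%N -> form (coords v) t i = 0.
  move=> ht hi; apply/eqP; rewrite eq_le.
  have t1 : (t < 23)%N by lia.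
  have t2 : (t + 10 < 23)%N by lia.
  move: (h _ _ t1 hi) (h _ _ t2 hi); rewrite !dot_mip_row //.
  have -> : (t < 13)%N by lia.
  have -> : (t + 10 < 13)%N = false by lia.
  by rewrite addnK w0 mulr0 sub0r oppr_ge0 => -> ->.
have blocks t i : (t < 8)%N -> (i < d)%N -> coords v (t * d + i) = 0.
  move=> + hi; have [_ [[f3 f4 f5 f6 f7] [f8 f9 f10 _ _]]] := formE (coords v) i hi.
  have z8 := zero 8%N i isT hi; have z9 := zero 9%N i isT hi.
  rewrite f8 in z8; rewrite f9 in z9.
  case: t => [|[|[|[|[|[|[|[|t]]]]]]]] // _.
  - lra.
  - by rewrite -f10 zero.
  - lra.
  - by rewrite -f3 zero.
  - by rewrite -f4 zero.
  - by rewrite -f5 zero.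
  - by rewrite -f6 zero.
  - by rewrite -f7 zero.
apply/colP => j; rewrite mxE -(mx_arrayE _ _ _ v j ord0) -/(coords v j).
have := ltn_ord j; rewrite {2}/n addn1 ltnS leq_eqVlt => /predU1P[->//|hj].
by rewrite (divn_eq j d) blocks ?ltn_divLR ?ltn_mod.
Qed.

Lemma mip_partner_is_row r : (r < 23 * d)%N ->
  mip_partner r = 0 \/ exists2 r', (r' < 23 * d)%N & mip_partner r = mip_row r'.
Proof.
move: r; apply/(blockwise d (fun r => mip_partner r = 0 \/
  exists2 r', (r' < 23 * d)%N & mip_partner r = mip_row r') _ d0) => t i ht hi.
have eqF t' : (t' < 23)%N -> (forall j, Gm (t * d + i) j = Fm (t' * d + i) j) ->
    exists2 r', (r' < 23 * d)%N & mip_partner (t * d + i) = mip_row r'.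
  move=> ht' h; exists (t' * d + i)%N; last by apply/colP => j; rewrite !mxE h.
  exact: ((blockwise d (fun r => r < 23 * d)%N 23 d0).1 (fun _ => id)).
case: (ltnP t 3) => t3.
  right; apply: (eqF t) => // j; rewrite mip_partner_entry // mip_row_entry // t3.
  by have -> : (t < 13)%N by lia.
case: (ltnP t 8) => t8.
  right; apply: (eqF (t + 5)%N) => [|j]; first by lia.
  rewrite mip_partner_entry // mip_row_entry // t8; have -> : (t + 5 < 13)%N by lia.
  by have -> : (t < 3)%N = false by lia.
left; apply/colP => j; rewrite !mxE mip_partner_entry //.
have -> : (t < 3)%N = false by lia.
by have -> : (t < 8)%N = false by lia.
Qed.

End Instance.

(** * Correctness of the solver *)

Section BigM.
Context {R : realType} {k : nat}.
Implicit Types (z phi delta : 'cV[R]_k) (M : R).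

Lemma bigM_perp M z phi delta : binary z -> bigM M z phi delta ->
  perp phi delta.
Proof.
move=> hz [h1 h2 h3 h4]; split=> // i.
have := h1 i; have := h2 i; have := h3 i; have := h4 i.
rewrite !mxE; have [->|->] := hz i.
  by rewrite mulr0 => _ _ h h'; rewrite (le_anti (introT andP (conj h h'))) mul0r.
rewrite subrr mulr0 => h h' _ _.
by rewrite (le_anti (introT andP (conj h h'))) mulr0.
Qed.

(** z = phi / phi is 0 where phi = 0 and 1 elsewhere; where it is 1, the
    complementarity condition forces delta = 0. *)
Lemma perp_bigM M z phi delta : perp phi delta ->
  lev phi (M *: ones k) -> lev delta (M *: ones k) ->
  (forall i, z i 0 = phi i 0 / phi i 0) ->
  bigM M z phi delta /\ binary z.
Proof.
move=> [h1 h2 h3] h4 h5 hz.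
have zE i : (phi i 0 = 0 /\ z i 0 = 0) \/ (delta i 0 = 0 /\ z i 0 = 1).
  have [p0|p0] := eqVneq (phi i 0) 0; first by left; rewrite hz p0 mul0r.
  right; rewrite hz divff //; split=> //.
  by have /eqP := h3 i; rewrite mulf_eq0 (negbTE p0) => /eqP.
split; last by move=> i; case: (zE i) => -[_ ->]; [left|right].
split=> // i; move: (h1 i) (h2 i) (h4 i) (h5 i); rewrite !mxE ?mulr1;
  case: (zE i) => -[-> ->]; rewrite ?subr0 ?subrr ?mulr0 ?mulr1 ?lexx //.
Qed.

End BigM.

Lemma mip_feasible_perp (R : realType) d m (D : mcp_data R d m) M x z :
  mip_feasible D M x z -> equalities D x /\ complementarities D x.
Proof.
move=> [h [h1 h2 h3 h4 h5] [b1 b2 b3 b4 b5]]; split=> //.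
by split; [exact: bigM_perp h1 | exact: bigM_perp h2 | exact: bigM_perp h3
  | exact: bigM_perp h4 | exact: bigM_perp h5].
Qed.

(** The search writes none of the data read by the row expressions. *)
Lemma eval_loop (R : realType) d m (D : mcp_data R d m) M (s : state R) e :
  all (mem [:: 0; 1; 6; 8]%N) (rvars e) -> all (mem (iota 0 7)) (rarrs e) ->
  agree (iota 3 8) (iota 20 8) (load D M) s ->
  reval s e = reval (loop_state D M (nvar s 6) (nvar s 8)) e.
Proof.
move=> /allP hv /allP ht [a1 a2]; apply: reval_ext => [v /hv|t /ht].
  by rewrite /= !inE => /or4P[]/eqP->; rewrite //= a1.
rewrite -[mem _ t]/(t \in iota 0 7) mem_iota => h.
by rewrite a2 // mem_iota; lia.
Qed.

Lemma solver_opt (R : realType) d m (D : mcp_data R d m) (M : R) :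
  (1 <= d)%N -> (m < d)%N -> properly_large D M ->
  wp solver (load D M) (fun s =>
    mip_global_optimum D M (out_cont d m s) (out_bin d m s)).
Proof.
move=> d0 md [x0 [E0 C0 O0 U0]].
set s0 := load D M.
apply: wp_seq.
pose Fm r j := reval (loop_state D M r j) mip_row_exp.
pose Gm r j := reval (loop_state D M r j) mip_partner_exp.
pose Cm j := reval (loop_state D M 0 j) mip_cost_exp.
have FE s : agree (iota 3 8) (iota 20 8) s0 s ->
  reval s mip_row_exp = Fm (nvar s 6) (nvar s 8) by exact: eval_loop.
have GE s : agree (iota 3 8) (iota 20 8) s0 s ->
  reval s mip_partner_exp = Gm (nvar s 6) (nvar s 8) by exact: eval_loop.
have CE s : agree (iota 3 8) (iota 20 8) s0 s ->
  reval s mip_cost_exp = Cm (nvar s 8).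
  by move=> h; rewrite (eval_loop _ _ _ D M s mip_cost_exp).
apply: (wp_cons _ _ _ _ (search_wp mip_row_exp mip_partner_exp mip_cost_exp s0 d Fm Gm Cm
  (erefl _) (erefl _) FE GE CE (homog d) (erefl _) _ _ _)).
- exact: (mip_partner_is_row D M d0 md).
- exact: (mip_pointed D M d0 md).
- exists (encode x0); first exact: (feas_encode D M d0 md).
  move=> y fy; rewrite !(dot_mip_cost D M d0 md) (decode_encode d0 md).
  by have [Ey Cy _] := feas_decode D M d0 md y fy; exact: O0.
move=> s1 a1 [y [fy oy yE]].
have [Ey Cy Uy] := feas_decode D M d0 md y fy.
set x := decode _ in Ey Cy Uy.
have sd1 : nvar s1 1 = d by rewrite a1.1.
apply: (wp_cons _ _ _ _ (output_wp d (iota 7 13) s1 sd1 isT isT)).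
move=> s2 _ h2.
have bE t (i : nat) : (t < 8)%N -> (i < d)%N ->
    rarr s1 27 (t * d + i) 0%N = mx_array y (t * d + i) 0.
  move=> ht hi; have hj := block_lt d t i ht hi.
  by rewrite (yE (Ordinal hj)) -(mx_arrayE _ _ _ y (Ordinal hj) ord0).
have md' (i : 'I_m) : (i < d)%N by apply: ltn_trans (ltn_ord i) md.
have oc : out_cont d m s2 = x.
  by congr ContVars; apply/colP => i; rewrite !mxE h2 // /out_val /= bE.
rewrite oc.
have [p1 p2 p3 p4 p5] := Cy.
have [[u1 u2 u3 u4 u5] [v1 v2] v3 v4 v5] := Uy.
have [] := perp_bigM M (z1 (out_bin d m s2)) _ _ p1 u1 v1.
  by move=> i; rewrite !mxE h2 // /out_val /= bE.
have [] := perp_bigM M (z2 (out_bin d m s2)) _ _ p2 u2 v2.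
  by move=> i; rewrite !mxE h2 // /out_val /= bE.
have [] := perp_bigM M (z3 (out_bin d m s2)) _ _ p3 u3 v3.
  by move=> i; rewrite !mxE h2 // /out_val /= bE.
have [] := perp_bigM M (z4 (out_bin d m s2)) _ _ p4 u4 v4.
  by move=> i; rewrite !mxE h2 // /out_val /= bE.
have [] := perp_bigM M (z5 (out_bin d m s2)) _ _ p5 u5 v5.
  by move=> i; rewrite !mxE h2 // /out_val /= bE.
move=> m5 b5 m4 b4 m3 b3 m2 b2 m1 b1; split; first by split.
move=> x' z' /mip_feasible_perp[E' C'].
apply: le_trans (O0 _ E' C').
have f0 := feas_encode D M d0 md x0 E0 C0 U0.
by have := oy _ f0; rewrite !(dot_mip_cost D M d0 md) (decode_encode d0 md).
Qed.

Theorem theorem3p5 (R : realType) :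
  exists p : cmd,
  forall (d m : nat) (D : mcp_data R d m) (M : R),
    (1 <= smp D)%N -> (1 <= d)%N -> (m < d)%N ->
    (Qmat D)^T = Qmat D ->
    \rank (Amat D) = m ->
    (exists b : 'cV[R]_d, in_Lambda D b) ->
    mcp_has_global_solution D ->
    0 < thr D -> 0 < lam D ->
    properly_large D M ->
    exists (N : nat) (s : state R),
      halts_within p (load D M) N s /\
      mip_global_optimum D M (out_cont d m s) (out_bin d m s).
Proof.
exists solver => d m D M _ d0 md _ _ _ _ _ _ large.
have [s run opt] := solver_opt R d m D M d0 md large.
by have [N stop] := exec_iter _ _ _ run [::]; exists N, s.
Qed.
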